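(* Let $f\colon[a,b]\to\mathbb{R}$ be Laplace integrable on $[a,b]$ and let $g\colon[a,b]\to\mathbb{R}$ be of bounded variation. Put $F(x)=\int_a^xf$ and $G(x)=\int_a^xg$ for $x\in[a,b]$. Then $fG$ is Laplace integrable on $[a,b]$ and \[\int_a^bfG=F(b)G(b)-(\mathsf{P})\int_a^bFg,\] where $(\mathsf{P})\int_a^b$ denotes the Perron integral.
   Context: Laplace integral on $[a,b]$: with lower/upper Laplace derivates $\underline{LD}_1F(x)$, $\overline{LD}_1F(x)$ being the minimum of the $\liminf$'s, resp. maximum of the $\limsup$'s, as $s\to\infty$ of $s^2\int_0^\delta e^{-st}[F(x+t)-F(x)]dt$ and $(-s^2)\int_0^\delta e^{-st}[F(x-t)-F(x)]dt$ (one-sided at endpoints), a major function of $f$ is a continuous $U$ with $\underline{LD}_1U\geqslant f$, $\underline{LD}_1U>-\infty$ everywhere on $[a,b]$, a minor function a continuous $V$ with $\overline{LD}_1V\leqslant f$, $\overline{LD}_1V<\infty$ everywhere, and $f$ is Laplace integrable if $\sup_V(V(b)-V(a))=\inf_U(U(b)-U(a))$ is finite, this value being $\int_a^bf$. *)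

(* Defs.v *)
From HB Require Import structures.
From mathcomp Require Import all_boot all_order all_algebra.
From mathcomp Require Import all_classical all_reals all_analysis.
Set Implicit Arguments. Unset Strict Implicit. Unset Printing Implicit Defensive.
Import Order.TTheory GRing.Theory Num.Theory.
Import numFieldNormedType.Exports.
Local Open Scope classical_set_scope.
Local Open Scope ring_scope.

Section Laplace.
Variable R : realType.
Implicit Types (a b x s : R) (U f : R -> R).

Definition lap_right b U x s : R :=
  s ^+ 2 * Rintegral (@lebesgue_measure R) `[0, b - x]
             (fun t => expR (- (s * t)) * (U (x + t) - U x)).

Definition lap_left a U x s : R :=
  - s ^+ 2 * Rintegral (@lebesgue_measure R) `[0, x - a]
             (fun t => expR (- (s * t)) * (U (x - t) - U x)).

Definition liminf_infty (h : R -> R) : \bar R :=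
  limf_einf (fun s => (h s)%:E) (pinfty_nbhs R).
Definition limsup_infty (h : R -> R) : \bar R :=
  limf_esup (fun s => (h s)%:E) (pinfty_nbhs R).

Definition lowerLD a b U x : \bar R :=
  if x == a then liminf_infty (lap_right b U x)
  else if x == b then liminf_infty (lap_left a U x)
  else Order.min (liminf_infty (lap_right b U x)) (liminf_infty (lap_left a U x)).

Definition upperLD a b U x : \bar R :=
  if x == a then limsup_infty (lap_right b U x)
  else if x == b then limsup_infty (lap_left a U x)
  else Order.max (limsup_infty (lap_right b U x)) (limsup_infty (lap_left a U x)).

Definition laplace_major a b f U : Prop :=
  {within `[a, b], continuous U} /\
  forall x, x \in `[a, b] -> ((f x)%:E <= lowerLD a b U x /\ -oo < lowerLD a b U x)%E.

Definition laplace_minor a b f V : Prop :=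
  {within `[a, b], continuous V} /\
  forall x, x \in `[a, b] -> (upperLD a b V x <= (f x)%:E /\ upperLD a b V x < +oo)%E.

Definition laplace_integral a b f (I : R) : Prop :=
  (forall V, laplace_minor a b f V -> V b - V a <= I) /\
  (forall e, 0 < e -> exists V, laplace_minor a b f V /\ I - e < V b - V a) /\
  (forall U, laplace_major a b f U -> I <= U b - U a) /\
  (forall e, 0 < e -> exists U, laplace_major a b f U /\ U b - U a < I + e).

Definition laplace_integrable a b f : Prop := exists I, laplace_integral a b f I.

(* the Laplace integral \int_a^b f (0 if f is not Laplace integrable) *)
Definition lapint a b f : R := xget 0 [set I | laplace_integral a b f I].

Definition lower_deriv a b U x : \bar R :=
  limf_einf (fun y => ((U y - U x) / (y - x))%:E) (within `[a, b] x^').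
Definition upper_deriv a b U x : \bar R :=
  limf_esup (fun y => ((U y - U x) / (y - x))%:E) (within `[a, b] x^').

Definition perron_major a b f U : Prop :=
  forall x, x \in `[a, b] -> ((f x)%:E <= lower_deriv a b U x /\ -oo < lower_deriv a b U x)%E.
Definition perron_minor a b f V : Prop :=
  forall x, x \in `[a, b] -> (upper_deriv a b V x <= (f x)%:E /\ upper_deriv a b V x < +oo)%E.

Definition perron_integral a b f (I : R) : Prop :=
  (forall V, perron_minor a b f V -> V b - V a <= I) /\
  (forall e, 0 < e -> exists V, perron_minor a b f V /\ I - e < V b - V a) /\
  (forall U, perron_major a b f U -> I <= U b - U a) /\
  (forall e, 0 < e -> exists U, perron_major a b f U /\ U b - U a < I + e).

End Laplace.

(* Main.v *)
Require Import Defs.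
From HB Require Import structures.
From mathcomp Require Import all_boot all_order all_algebra.
From mathcomp Require Import all_classical all_reals all_analysis.
From mathcomp Require Import measurable_realfun ring lra.
Import Order.TTheory GRing.Theory Num.Theory.
Import numFieldNormedType.Exports.
Set Implicit Arguments. Unset Strict Implicit. Unset Printing Implicit Defensive.
Local Open Scope classical_set_scope.
Local Open Scope ring_scope.

(* If [U] is a major function of [f] and [g] is bounded, measurable and
   nonnegative, then [M = U G - \int U g] is a major function of [f G]: the
   difference [M y - M x - G x (U y - U x) = \int_x^y (U y - U) g] is [o(y - x)],
   so the Laplace derivates of [M] at [x] are [G x] times those of [U].
   Major and minor functions of [f] differ from [F] by a uniformly small amount
   up to a constant, which gives [\int f G = F b G b - \int F g] with a Lebesgue
   integral on the right; adding a constant to [g] removes the sign condition.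
   It remains to identify the Lebesgue integrals of [g] and of [F g] with the
   Laplace, resp. Perron, ones.  Both functions are Riemann integrable, i.e.
   squeezed between continuous functions with close integrals, and the primitive
   of a continuous function above [phi] is a major function of [phi] in either
   sense. *)

(** The product [U G] alone is not a candidate: its increment is
    [G x (U y - U x) + U y (G y - G x)], and the last term need have no derivate at [x], since [G]
    is only a primitive of a bounded measurable function. Subtracting the integral of [U g] removes
    exactly that term up to [o(y - x)]. Such an error is harmless because the Laplace derivate of a
    linear function is its slope: an error at most [h |y - x|] for every [h > 0] shifts no derivate.
    The sign condition on [g] serves twice. A lower bound on a derivate survives multiplication by
    [G x] only if [G x >= 0], and comparing the integrals of [U g] and [F g] from a comparison of
    [U] with [F] needs [g >= 0]. Since [f] need not be Lebesgue integrable, Lebesgue integrals are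
    taken only of [g] and of its products with continuous functions. *)

(** * Upper and lower limits along a filter *)
Section Limf.
Context {T : choiceType} {X : filteredType T} {R : realType}.
Implicit Types (F : set_system X) (h : X -> R).

(** With its mirror image below, this is how extended real derivates are reduced to real
    inequalities: along [+oo] for Laplace, along punctured neighbourhoods within the segment for
    Perron. *)
Lemma limf_esup_le F {FF : Filter F} h (c : R) :
  (limf_esup (fun s => (h s)%:E) F <= c%:E)%E <->
  (forall e : R, 0 < e -> \forall s \near F, h s <= c + e).
Proof.
split=> [hc e e0|hc].
  have : (limf_esup (fun s => (h s)%:E) F < (c + e)%:E)%E.
    by rewrite (le_lt_trans hc)// lte_fin ltrDl.
  move=> /ereal_inf_lt[_ [V FV <-]] /ltW Vce.
  apply: filterS FV => s Vs; rewrite -lee_fin (le_trans _ Vce)//.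
  by apply: ereal_sup_ubound; exists s.
apply/lee_addgt0Pr => e e0; rewrite -EFinD.
apply: (@le_trans _ _ (ereal_sup ((fun s => (h s)%:E) @` [set s | h s <= c + e]))).
  by apply: ereal_inf_lbound; exists [set s | h s <= c + e] => //; exact: hc.
by apply: ge_ereal_sup => _ [s /= hs <-]; rewrite lee_fin.
Qed.

Lemma limf_einf_ge F {FF : Filter F} h (c : R) :
  (c%:E <= limf_einf (fun s => (h s)%:E) F)%E <->
  (forall e : R, 0 < e -> \forall s \near F, c - e <= h s).
Proof.
rewrite /limf_einf leeNr -EFinN (limf_esup_le (\- h)).
by split=> H e /H; apply: filterS => s /=; lra.
Qed.

End Limf.

(** * Continuity and integrability on a segment *)
Section WithinContinuity.
Context {R : realType}.
Notation mu := (@lebesgue_measure R).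
Implicit Types (a b x C D : R) (f g phi U : R -> R).

Lemma within_itv_continuousP a b f :
  {within `[a, b], continuous f} <->
  (forall x, x \in `[a, b] -> forall e : R, 0 < e ->
    exists2 d : R, 0 < d & forall y, y \in `[a, b] -> `|y - x| < d -> `|f y - f x| < e).
Proof.
rewrite subspace_continuousP; split=> H x xab.
  move=> e e0; have /cvgrPdist_lt/(_ _ e0) := H x xab.
  rewrite near_withinE => -[d /= d0 dH]; exists d => // y yab yx.
  by rewrite distrC; apply: dH => //=; rewrite distrC.
apply/cvgrPdist_lt => e e0; have [d d0 dH] := H x xab e e0.
rewrite near_withinE; exists d => //= y /= yx yab.
by rewrite distrC; apply: dH => //; rewrite distrC.
Qed.

Lemma within_itv_continuous_comp a b c d f (g : R -> R) :
  {within `[a, b], continuous f} -> {within `[c, d], continuous g} ->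
  (forall x, x \in `[c, d] -> g x \in `[a, b]) ->
  {within `[c, d], continuous (f \o g)}.
Proof.
move=> /within_itv_continuousP cf /within_itv_continuousP cg cdab.
apply/within_itv_continuousP => x xcd e e0.
have [r r0 rH] := cf _ (cdab _ xcd) _ e0.
have [r' r'0 rH'] := cg _ xcd _ r0.
by exists r' => // y ycd yx; apply: rH; [exact: cdab|exact: rH'].
Qed.

Lemma within_itv_continuous_cst a b (k : R) : {within `[a, b], continuous (fun=> k)}.
Proof. by apply: continuous_subspaceT => t; exact: cvg_cst. Qed.

Lemma within_itv_continuousN a b U : {within `[a, b], continuous U} ->
  {within `[a, b], continuous (\- U)}.
Proof. by move=> cU z; exact: (@continuousN _ R^o (subspace `[a, b]) U z (cU z)). Qed.

Lemma within_itv_continuous_id a b : {within `[a, b], continuous (fun x : R => x)}.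
Proof. by apply: continuous_subspaceT => t; exact: cvg_id. Qed.

Lemma within_itv_continuousM a b f g :
  {within `[a, b], continuous f} -> {within `[a, b], continuous g} ->
  {within `[a, b], continuous (f \* g)}.
Proof.
by move=> cf cg z; exact: (@continuousM R (subspace `[a, b]) f g z (cf z) (cg z)).
Qed.

Lemma within_itv_continuousB a b f g :
  {within `[a, b], continuous f} -> {within `[a, b], continuous g} ->
  {within `[a, b], continuous (f \- g)}.
Proof.
by move=> cf cg z; exact: (@continuousB _ R^o (subspace `[a, b]) f g z (cf z) (cg z)).
Qed.

Lemma within_itv_continuousD a b f g :
  {within `[a, b], continuous f} -> {within `[a, b], continuous g} ->
  {within `[a, b], continuous (f \+ g)}.
Proof.
by move=> cf cg z; exact: (@continuousD _ R^o (subspace `[a, b]) f g z (cf z) (cg z)).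
Qed.

Lemma within_itv_continuous_shift a b U x : {within `[a, b], continuous U} ->
  x \in `[a, b] -> {within `[0, b - x], continuous (fun t => U (x + t))}.
Proof.
rewrite in_itv/= => cU /andP[ax xb].
apply: (within_itv_continuous_comp (a := a) (b := b) (f := U)) => //.
  apply: continuous_subspaceT => t.
  by apply: (@cvgD _ R^o); [exact: cvg_cst|exact: cvg_id].
by move=> t; rewrite !in_itv/= => /andP[? ?]; apply/andP; split; lra.
Qed.

Lemma within_itv_continuous_reflect a b U x : {within `[a, b], continuous U} ->
  x \in `[a, b] -> {within `[0, x - a], continuous (fun t => U (x - t))}.
Proof.
rewrite in_itv/= => cU /andP[ax xb].
apply: (within_itv_continuous_comp (a := a) (b := b) (f := U)) => //.
  apply: continuous_subspaceT => t.
  by apply: (@cvgB _ R^o); [exact: cvg_cst|exact: cvg_id].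
by move=> t; rewrite !in_itv/= => /andP[? ?]; apply/andP; split; lra.
Qed.

Lemma within_itv_bounded a b f : {within `[a, b], continuous f} ->
  exists2 M : R, 0 <= M & forall x, x \in `[a, b] -> `|f x| <= M.
Proof.
move=> cf; have := continuous_compact cf (@segment_compact _ a b).
move=> /compact_bounded[M [Mr H]].
exists (`|M| + 1); first by rewrite addr_ge0.
move=> x xab; apply: (H (`|M| + 1)).
  by rewrite (le_lt_trans (real_ler_norm Mr))// ltrDl.
by exists x.
Qed.

Lemma within_itv_integrable a b f : {within `[a, b], continuous f} ->
  (@lebesgue_measure R).-integrable `[a, b] (EFin \o f).
Proof.
by move=> cf; apply: continuous_compact_integrable => //; exact: segment_compact.
Qed.

Lemma bounded_integrable a b phi D : measurable_fun `[a, b] phi ->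
  (forall x, x \in `[a, b] -> `|phi x| <= D) ->
  mu.-integrable `[a, b] (EFin \o phi).
Proof.
move=> mphi phiD; apply: measurable_bounded_integrable => //.
  by apply: compact_finite_measure; exact: segment_compact.
exists D; split; first exact: num_real.
by move=> M DM x xab; apply: le_trans (ltW DM); exact: phiD.
Qed.

Lemma within_itv_measurable a b U : {within `[a, b], continuous U} ->
  measurable_fun `[a, b] U.
Proof. by move=> cU; apply: subspace_continuous_measurable_fun. Qed.

Lemma continuousM_integrable a b U g C : {within `[a, b], continuous U} ->
  measurable_fun `[a, b] g -> (forall x, x \in `[a, b] -> `|g x| <= C) ->
  mu.-integrable `[a, b] (EFin \o (U \* g)).
Proof.
move=> cU mg gC; have [M M0 UM] := within_itv_bounded cU.
apply: (@bounded_integrable _ _ _ (M * C)).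
  by apply: measurable_funM => //; exact: within_itv_measurable.
by move=> x xab /=; rewrite normrM ler_pM// ?UM ?gC.
Qed.

End WithinContinuity.

(** * Asymptotics of truncated Laplace integrals *)
Section Lapl.
Context {R : realType}.
Notation mu := (@lebesgue_measure R).
Implicit Types (phi psi : R -> R) (c d e h k m s t : R).

(** The kernel [s^2 exp(-s t)] has first moment 1 on the half-line, so for large [s] the value
    measures the slope of [phi] at 0. *)
Definition lapl d phi s : R :=
  s ^+ 2 * Rintegral mu `[0, d] (fun t => expR (- (s * t)) * phi t).

Lemma expRNM_continuous s : continuous (fun t : R => expR (- (s * t))).
Proof.
move=> t; apply: continuous_comp; last exact: continuous_expR.
apply: (@cvgN _ R^o); apply: (@cvgM R); [exact: cvg_cst|exact: cvg_id].
Qed.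

Lemma within_itv_continuous_expM d phi s : {within `[0, d], continuous phi} ->
  {within `[0, d], continuous (fun t => expR (- (s * t)) * phi t)}.
Proof.
move=> cphi; apply: within_itv_continuousM => //.
by apply: continuous_subspaceT; exact: expRNM_continuous.
Qed.

Lemma laplD d phi psi s : {within `[0, d], continuous phi} ->
  {within `[0, d], continuous psi} ->
  lapl d (phi \+ psi) s = lapl d phi s + lapl d psi s.
Proof.
move=> cphi cpsi; rewrite /lapl -mulrDr -RintegralD//=.
- by congr (_ * _); apply: eq_Rintegral => t _; rewrite mulrDr.
- by apply: within_itv_integrable; exact: within_itv_continuous_expM.
- by apply: within_itv_integrable; exact: within_itv_continuous_expM.
Qed.

Lemma laplZ d k phi s : {within `[0, d], continuous phi} ->
  lapl d (fun t => k * phi t) s = k * lapl d phi s.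
Proof.
move=> cphi; rewrite /lapl mulrCA; congr (_ * _); rewrite -RintegralZl//=.
  by apply: eq_Rintegral => t _; rewrite mulrCA.
by apply: within_itv_integrable; exact: within_itv_continuous_expM.
Qed.

Lemma lapl_le d phi psi s : {within `[0, d], continuous phi} ->
  {within `[0, d], continuous psi} ->
  (forall t, t \in `[0, d] -> phi t <= psi t) -> lapl d phi s <= lapl d psi s.
Proof.
move=> cphi cpsi le_phi_psi; rewrite /lapl ler_wpM2l ?sqr_ge0//.
apply: le_Rintegral => //.
- by apply: within_itv_integrable; exact: within_itv_continuous_expM.
- by apply: within_itv_integrable; exact: within_itv_continuous_expM.
- by move=> t td; apply: ler_wpM2l; [exact: expR_ge0|exact: le_phi_psi].
Qed.

(* [exp (s h)] beats the cubic [(s h)^3 / 6]. *)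
Lemma sqr_expRN_small h k e : 0 < h -> 0 < e ->
  \forall s \near +oo, s ^+ 2 * expR (- (s * h)) * k <= e.
Proof.
move=> h0 e0; near=> s.
have s0 : 0 < s by near: s; exact: nbhs_pinfty_gt.
have sh0 : 0 < s * h by rewrite mulr_gt0.
have sk : 6 * `|k| / (h ^+ 3 * e) <= s.
  by near: s; apply: nbhs_pinfty_ge; rewrite num_real.
rewrite expRN mulrAC ler_pdivrMr ?expR_gt0//.
apply: (@le_trans _ _ (e * ((s * h) ^+ 3 / 6))); last first.
  apply: ler_wpM2l; first exact: ltW.
  apply: le_trans (expR_ge1Dxn 2%N (ltW sh0)).
  by rewrite (_ : 3`! = 6)%N// lerDr.
move: sk; rewrite ler_pdivrMr ?mulr_gt0 ?exprn_gt0// => sk.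
have -> : e * ((s * h) ^+ 3 / 6) = s ^+ 2 * (s * (h ^+ 3 * e) / 6) by field.
apply: ler_wpM2l; first exact: sqr_ge0.
by rewrite ler_pdivlMr// mulrC (le_trans _ sk)// ler_wpM2l// ler_norm.
Unshelve. all: by end_near. Qed.

(** Beyond [h] the kernel is at most [s^2 exp(-s h)] and [phi] is bounded, so the tail tends to 0.
    Hence Laplace derivates do not depend on the length of the interval of integration. *)
Lemma lapl_tail d h phi e : {within `[0, d], continuous phi} ->
  0 < h -> h <= d -> 0 < e ->
  \forall s \near +oo, `|lapl d phi s - lapl h phi s| <= e.
Proof.
move=> cphi h0 hd e0; have [M M0 HM] := within_itv_bounded cphi.
near=> s.
have s0 : 0 < s by near: s; exact: nbhs_pinfty_gt.
have iphi : mu.-integrable `[0, d] (EFin \o (fun t => expR (- (s * t)) * phi t)).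
  by apply: within_itv_integrable; exact: within_itv_continuous_expM.
have ihd : mu.-integrable `]h, d] (EFin \o (fun t => expR (- (s * t)) * phi t)).
  apply: integrableS iphi => //.
  by move=> t /=; rewrite !in_itv/= => /andP[ht ->]; rewrite (ltW (lt_trans h0 ht)).
rewrite /lapl -mulrBr Rintegral_itvB// ?bnd_simp//; last exact: ltW.
rewrite normrM ger0_norm ?sqr_ge0//.
apply: (@le_trans _ _ (s ^+ 2 * Rintegral mu `]h, d] (fun=> expR (- (s * h)) * M))).
  apply: ler_wpM2l; first exact: sqr_ge0.
  apply: (le_trans (le_normr_Rintegral _ _)) => //.
  apply: le_Rintegral => //=.
  - by have /= := integrable_norm ihd.
  - apply: (@integrableS _ _ _ mu `[h, d]) => //; first exact: subset_itv_oc_cc.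
    by apply: within_itv_integrable; apply: continuous_subspaceT => ?; exact: cst_continuous.
  - move=> t; rewrite /= in_itv/= => /andP[ht td].
    rewrite normrM ger0_norm ?expR_ge0//; apply: ler_pM; rewrite ?expR_ge0//.
      by rewrite ler_expR lerN2 ler_pM2l// ltW.
    by apply: HM; rewrite in_itv/= td (le_trans (ltW h0) (ltW ht)).
rewrite Rintegral_cst//= lebesgue_measure_itv/= lte_fin.
have -> : fine (if h < d then (d%:E - h%:E)%E else 0%E) = d - h.
  by move: hd; rewrite le_eqVlt => /predU1P[->|->//]; rewrite ltxx subrr.
rewrite -mulrA mulrA.
near: s; exact: sqr_expRN_small.
Unshelve. all: by end_near. Qed.

(** The limit inferior of [lapl d phi] at infinity is at least [c], written without extended
    reals. *)
Definition lap_ge d phi c : Prop :=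
  forall e, 0 < e -> \forall s \near +oo, c - e <= lapl d phi s.

Lemma lap_geD d phi psi c c' : {within `[0, d], continuous phi} ->
  {within `[0, d], continuous psi} ->
  lap_ge d phi c -> lap_ge d psi c' -> lap_ge d (phi \+ psi) (c + c').
Proof.
move=> cphi cpsi hphi hpsi e e0; have e20 : 0 < e / 2 by rewrite divr_gt0.
have := hphi _ e20; apply: filterS2 (hpsi _ e20) => s; rewrite laplD//; lra.
Qed.

Lemma lap_geZ d k phi c : 0 <= k -> {within `[0, d], continuous phi} ->
  lap_ge d phi c -> lap_ge d (fun t => k * phi t) (k * c).
Proof.
move=> k0 cphi hphi e e0; have k10 : 0 < k + 1 by rewrite ltr_wpDl.
have := hphi _ (divr_gt0 e0 k10); apply: filterS => s hs.
rewrite laplZ//; apply: le_trans (ler_wpM2l k0 hs).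
rewrite mulrBr lerD2l lerN2 mulrA ler_pdivrMr// mulrC.
by apply: ler_wpM2l; [exact: ltW|rewrite lerDl].
Qed.

Lemma lap_ge_approx d phi c :
  (forall h, 0 < h -> lap_ge d phi (c - h)) -> lap_ge d phi c.
Proof.
move=> H e e0; have e20 : 0 < e / 2 by rewrite divr_gt0.
by apply: filterS (H _ e20 _ e20) => s; lra.
Qed.

(** Up to tails only [[0, h]] counts, and there the positive kernel preserves the order. Allowing
    [d1] and [d2] to differ is what permits restricting a major function to a shorter segment. *)
Lemma lap_ge_local d1 d2 h phi psi c : {within `[0, d1], continuous phi} ->
  {within `[0, d2], continuous psi} -> 0 < h -> h <= d1 -> h <= d2 ->
  (forall t, t \in `[0, h] -> phi t <= psi t) ->
  lap_ge d1 phi c -> lap_ge d2 psi c.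
Proof.
move=> cphi cpsi h0 hd1 hd2 le_phi_psi hphi e e0.
have e30 : 0 < e / 3 by rewrite divr_gt0.
have cphih : {within `[0, h], continuous phi}.
  by apply: continuous_subspaceW cphi; exact: subset_itvl.
have cpsih : {within `[0, h], continuous psi}.
  by apply: continuous_subspaceW cpsi; exact: subset_itvl.
near=> s.
have H1 : c - e / 3 <= lapl d1 phi s by near: s; exact: hphi.
have H2 : `|lapl d1 phi s - lapl h phi s| <= e / 3 by near: s; exact: lapl_tail.
have H3 : `|lapl d2 psi s - lapl h psi s| <= e / 3 by near: s; exact: lapl_tail.
have H4 : lapl h phi s <= lapl h psi s.
  exact: lapl_le.
move: H2 H3; rewrite !ler_norml => /andP[_ H2] /andP[H3 _]; lra.
Unshelve. all: by end_near. Qed.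

Lemma lapl_id d s : 0 < d -> 0 < s ->
  lapl d id s = 1 - (s * d + 1) * expR (- (s * d)).
Proof.
move=> d0 s0; have sN0 : s != 0 by rewrite gt_eqF.
(* An antiderivative of [t exp(-s t)], from one integration by parts. *)
pose P : R -> R := fun t => - (t / s + s ^- 2) * expR (- (s * t)).
have dP t : is_derive t (1 : R) P (expR (- (s * t)) * t).
  rewrite /P; apply: is_derive_eq; rewrite !scaler1 /GRing.scale/=.
  by field.
have cP : continuous P.
  move=> t; apply: differentiable_continuous; apply/derivable1_diffP.
  exact: ex_derive.
rewrite /lapl /Rintegral (@continuous_FTC2 _ _ P)//.
- by rewrite /= /P mulr0 oppr0 expR0; field.
- apply: within_itv_continuous_expM.
  exact: within_itv_continuous_id.
- split => [t _||]; first exact: ex_derive.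
  + by apply: cvg_at_right_filter; exact: cP.
  + by apply: cvg_at_left_filter; exact: cP.
- by move=> t _; rewrite derive1E; exact: derive_val.
Qed.

Lemma lap_ge_linear d m : 0 < d -> lap_ge d (fun t => m * t) m.
Proof.
move=> d0 e e0; near=> s.
have s1 : 1 <= s by near: s; exact: nbhs_pinfty_ge.
have s0 : 0 < s by rewrite (lt_le_trans _ s1).
rewrite (@laplZ d m id); last exact: within_itv_continuous_id.
rewrite lapl_id//.
suff : m * ((s * d + 1) * expR (- (s * d))) <= e by lra.
(* For [s >= 1] one has [s d + 1 <= s^2 (d + 1)], which brings the remainder of [lapl_id] under
   [sqr_expRN_small]. *)
have : s ^+ 2 * expR (- (s * d)) * (`|m| * (d + 1)) <= e.
  by near: s; exact: sqr_expRN_small.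
apply: le_trans; rewrite [leRHS]mulrAC mulrA.
apply: ler_wpM2r; first exact: expR_ge0.
apply: (@le_trans _ _ (`|m| * (s * d + 1))).
  by apply: ler_wpM2r (ler_norm _); rewrite addr_ge0// mulr_ge0 ?ltW.
rewrite mulrCA; apply: ler_wpM2l => //.
have s2 : s <= s ^+ 2 by rewrite expr2 ler_peMl// ltW.
have := ler_wpM2r (ltW d0) s2; lra.
Unshelve. all: by end_near. Qed.

(** Comparison near 0 with the zero function, whose Laplace integral vanishes; meant for increments
    starting at a maximum. *)
Lemma lap_ge_le0 d h phi c : {within `[0, d], continuous phi} ->
  0 < h -> h <= d -> (forall t, t \in `[0, h] -> phi t <= 0) ->
  lap_ge d phi c -> c <= 0.
Proof.
move=> cphi h0 hd phi0 hc.
have c0 : {within `[0, d], continuous (fun=> 0 : R)}.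
  exact: within_itv_continuous_cst.
have {}hc := lap_ge_local cphi c0 h0 hd hd phi0 hc.
apply/ler_addgt0Pr => e e0; near (pinfty_nbhs R) => s.
have : c - e <= lapl d (fun=> 0) s by near: s; exact: hc.
have -> : lapl d (fun=> 0) s = 0.
  rewrite /lapl; under eq_Rintegral do rewrite mulr0.
  by rewrite Rintegral_cst//= mul0r mulr0.
lra.
Unshelve. all: by end_near. Qed.

(** The error [h t] has Laplace derivate exactly [h], and [h] is arbitrary. Both the integration by
    parts and the primitives of continuous functions reach Laplace derivates through this lemma. *)
Lemma lap_ge_by_increment d phi psi c k : 0 < d -> 0 <= k ->
  {within `[0, d], continuous phi} -> {within `[0, d], continuous psi} ->
  lap_ge d phi c ->
  (forall h, 0 < h -> exists2 r : R, 0 < r & forall t, t \in `[0, d] -> t < r ->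
    k * phi t - h * t <= psi t) ->
  lap_ge d psi (k * c).
Proof.
move=> d0 k0 cphi cpsi hphi H; apply: lap_ge_approx => h h0.
have [r r0 Hr] := H h h0.
have cid : {within `[0, d], continuous (fun t => - h * t)}.
  apply: within_itv_continuousM; first exact: within_itv_continuous_cst.
  exact: within_itv_continuous_id.
have ckphi : {within `[0, d], continuous (fun t => k * phi t)}.
  by apply: within_itv_continuousM => //; exact: within_itv_continuous_cst.
have := lap_geD ckphi cid (lap_geZ k0 cphi hphi) (lap_ge_linear (- h) d0).
(* Half of [r], because the comparison is made on a closed interval while the hypothesis asks for
   [t < r]. *)
have md : Num.min (r / 2) d <= d by rewrite ge_min lexx orbT.
apply: (lap_ge_local (h := Num.min (r / 2) d)) => //.
- exact: within_itv_continuousD.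
- by rewrite lt_min d0 divr_gt0.
- move=> t; rewrite in_itv/= => /andP[t0]; rewrite le_min => /andP[tr td].
  by have := Hr t; rewrite in_itv/= t0 td => /(_ isT) H1; rewrite mulNr; apply: H1; lra.
Qed.

End Lapl.

(** * Major and minor functions *)
Section LaplaceMajor.
Context {R : realType}.
Implicit Types (a b x s t : R) (f g U V W : R -> R).

Lemma within_itv_continuous_incr a b U x : {within `[a, b], continuous U} ->
  x \in `[a, b] -> {within `[0, b - x], continuous (fun t => U (x + t) - U x)}.
Proof.
move=> cU xab; apply: within_itv_continuousB; last exact: within_itv_continuous_cst.
exact: within_itv_continuous_shift.
Qed.

Lemma within_itv_continuous_decr a b U x : {within `[a, b], continuous U} ->
  x \in `[a, b] -> {within `[0, x - a], continuous (fun t => U x - U (x - t))}.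
Proof.
move=> cU xab; apply: within_itv_continuousB; first exact: within_itv_continuous_cst.
exact: within_itv_continuous_reflect.
Qed.

(** With the sign moved under the integral, left derivates become [lapl] of an increment, so the
    lemmas on [lap_ge] serve both sides of [x]. *)
Lemma lap_leftE a b U x s : {within `[a, b], continuous U} -> x \in `[a, b] ->
  lap_left a U x s = lapl (x - a) (fun t => U x - U (x - t)) s.
Proof.
move=> cU xab; rewrite /lap_left mulNr -mulrN /lapl; congr (_ * _).
rewrite -mulN1r -RintegralZl//=; last first.
  apply: within_itv_integrable; apply: within_itv_continuous_expM.
  apply: within_itv_continuousB; last exact: within_itv_continuous_cst.
  exact: within_itv_continuous_reflect.
by apply: eq_Rintegral => t _; ring.
Qed.

(* The clause [-oo < lowerLD a b U x] follows from [f x <= lowerLD a b U x]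
   because [f] is real-valued. *)
Lemma laplace_majorP a b f U : a < b ->
  laplace_major a b f U <->
  {within `[a, b], continuous U} /\
  (forall x, x \in `[a, b] ->
    (x < b -> lap_ge (b - x) (fun t => U (x + t) - U x) (f x)) /\
    (a < x -> lap_ge (x - a) (fun t => U x - U (x - t)) (f x))).
Proof.
move=> ab.
have lowerP x : {within `[a, b], continuous U} -> x \in `[a, b] ->
    ((f x)%:E <= lowerLD a b U x)%E <->
    ((x < b -> lap_ge (b - x) (fun t => U (x + t) - U x) (f x)) /\
     (a < x -> lap_ge (x - a) (fun t => U x - U (x - t)) (f x))).
  move=> cU xab; move: (xab); rewrite in_itv/= => /andP[ax xb].
  have rP : ((f x)%:E <= liminf_infty (lap_right b U x))%E <->
      lap_ge (b - x) (fun t => U (x + t) - U x) (f x).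
    exact: limf_einf_ge.
  have lP : ((f x)%:E <= liminf_infty (lap_left a U x))%E <->
      lap_ge (x - a) (fun t => U x - U (x - t)) (f x).
    rewrite limf_einf_ge; split=> H e e0; apply: filterS (H _ e0) => s;
    by rewrite (lap_leftE _ cU xab).
  move: rP lP; rewrite /lowerLD; have [->|xa] := eqVneq x a => [rP _|].
    rewrite rP; split=> [H|[/(_ ab)]//]; split=> //; by rewrite ltxx.
  have {}ax : a < x by rewrite lt_neqAle eq_sym xa.
  have [xbE|xb'] := eqVneq x b => [_ lP|rP lP].
    rewrite lP; split=> [H|[_ /(_ ax)]//]; split=> // xltb.
    by rewrite xbE ltxx in xltb.
  have {}xb' : x < b by rewrite lt_neqAle xb'.
  rewrite le_min; split=> [/andP[H1 H2]|[H1 H2]].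
    by split=> _; [exact: rP.1 H1|exact: lP.1 H2].
  by rewrite (rP.2 (H1 xb')) (lP.2 (H2 ax)).
split=> [[cU HU]|[cU HU]]; split=> // x xab; first exact/(lowerP _ cU xab)/(HU x xab).1.
have /(lowerP _ cU xab) lef := HU x xab.
by split => //; rewrite (lt_le_trans _ lef)// ltNyr.
Qed.

(** Negation exchanges limits superior and inferior, maximum and minimum. Facts about minor
    functions are drawn from those about major functions through this equivalence. *)
Lemma laplace_minorN a b f V : a < b ->
  laplace_minor a b f V <-> laplace_major a b (\- f) (\- V).
Proof.
move=> ab.
have upperE x : {within `[a, b], continuous V} -> x \in `[a, b] ->
    upperLD a b V x = (- lowerLD a b (\- V)%R x)%E.
  move=> cV xab.
  have rN : liminf_infty (lap_right b (\- V) x) = (- limsup_infty (lap_right b V x))%E.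
    rewrite -limf_einfN; congr limf_einf; apply/funext => s; rewrite -EFinN.
    congr EFin; rewrite /lap_right -mulrN; congr (_ * _).
    rewrite -mulN1r -RintegralZl//=; last first.
      apply: within_itv_integrable; apply: within_itv_continuous_expM.
      exact: within_itv_continuous_incr.
    by apply: eq_Rintegral => t _; ring.
  have lN : liminf_infty (lap_left a (\- V) x) = (- limsup_infty (lap_left a V x))%E.
    rewrite -limf_einfN; congr limf_einf; apply/funext => s; rewrite -EFinN.
    have cNV := within_itv_continuousN cV.
    congr EFin; rewrite (lap_leftE _ cV xab) (lap_leftE _ cNV xab) -[RHS]mulN1r -laplZ.
      by congr lapl; apply/funext => t; rewrite /=; ring.
    exact: within_itv_continuous_decr.
  rewrite /upperLD /lowerLD rN lN; case: ifP => _; first by rewrite oppeK.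
  by case: ifP => _; [rewrite oppeK|rewrite -oppe_max oppeK].
split=> -[cV HV].
  have cNV := within_itv_continuousN cV.
  split=> // x xab; move: (HV x xab); rewrite upperE//=.
  by rewrite leeNl -EFinN lteNl => -[].
have cV' : {within `[a, b], continuous V}.
  have := within_itv_continuousN cV; suff -> : (\- (\- V)) = V by [].
  by apply/funext => t /=; rewrite opprK.
split=> // x xab; move: (HV x xab); rewrite upperE//=.
by rewrite leeNl EFinN lteNl.
Qed.

Lemma laplace_majorW a b f g U : (forall x, x \in `[a, b] -> g x <= f x) ->
  laplace_major a b f U -> laplace_major a b g U.
Proof.
move=> gf [cU HU]; split=> // x xab; have [Hf ?] := HU _ xab; split=> //.
by apply: le_trans Hf; rewrite lee_fin gf.
Qed.

Lemma laplace_majorD a b f g U W : a < b -> laplace_major a b f U ->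
  laplace_major a b g W -> laplace_major a b (f \+ g) (U \+ W).
Proof.
move=> ab /(laplace_majorP _ _ ab)[cU HU] /(laplace_majorP _ _ ab)[cW HW].
have cUW := within_itv_continuousD cU cW.
apply/laplace_majorP => //; split=> // x xab; split.
  move=> xb; have := lap_geD (within_itv_continuous_incr cU xab)
    (within_itv_continuous_incr cW xab) ((HU x xab).1 xb) ((HW x xab).1 xb).
  by congr lap_ge; apply/funext => t /=; ring.
move=> ax; have := lap_geD (within_itv_continuous_decr cU xab)
  (within_itv_continuous_decr cW xab) ((HU x xab).2 ax) ((HW x xab).2 ax).
by congr lap_ge; apply/funext => t /=; ring.
Qed.

Lemma laplace_majorB a b f g U V : a < b -> laplace_major a b f U ->
  laplace_minor a b g V -> laplace_major a b (f \- g) (U \- V).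
Proof. by move=> ab HU /(laplace_minorN _ _ ab); exact: laplace_majorD. Qed.

Lemma laplace_minorB a b f g U V : a < b -> laplace_minor a b f V ->
  laplace_major a b g U -> laplace_minor a b (f \- g) (V \- U).
Proof.
move=> ab HV HU; apply/(laplace_minorN _ _ ab).
have := laplace_majorB ab HU HV.
by congr laplace_major; apply/funext => t /=; rewrite opprB.
Qed.

(** At the new right endpoint only the left derivate is required, and it is unchanged; elsewhere the
    right derivate is local. *)
Lemma laplace_major_restrict a b x f U : a < x -> x <= b ->
  laplace_major a b f U -> laplace_major a x f U.
Proof.
move=> ax xb; have ab := lt_le_trans ax xb.
move=> /(laplace_majorP _ _ ab)[cU HU]; apply/laplace_majorP => //.
have cUx : {within `[a, x], continuous U}.
  by apply: continuous_subspaceW cU; exact: subset_itvl.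
split=> // y yax; have yab : y \in `[a, b].
  by move: yax; rewrite !in_itv/= => /andP[-> /le_trans]; exact.
split=> [yx|ay]; last exact: (HU y yab).2.
apply: (@lap_ge_local _ _ _ (x - y)) ((HU y yab).1 (lt_le_trans yx xb)) => //.
- exact: within_itv_continuous_incr.
- exact: within_itv_continuous_incr.
- by rewrite subr_gt0.
- by rewrite lerD2r.
Qed.

Lemma laplace_minor_restrict a b x f V : a < x -> x <= b ->
  laplace_minor a b f V -> laplace_minor a x f V.
Proof.
move=> ax xb; have ab := lt_le_trans ax xb.
move=> /(laplace_minorN _ _ ab)/(laplace_major_restrict ax xb).
by move=> /(laplace_minorN _ _ ax).
Qed.

(* At a maximum of [W + k id] over [c, d] other than [d], the right
   Laplace derivate of [W + k id] would be both [>= k] and [<= 0]. *)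
Lemma laplace_major0_nondecreasing a b W : a < b ->
  laplace_major a b (fun=> 0) W ->
  forall c d, c \in `[a, b] -> d \in `[a, b] -> c <= d -> W c <= W d.
Proof.
move=> ab /(laplace_majorP _ _ ab)[cW HW] c d; rewrite !in_itv/= => /andP[ac cb].
move=> /andP[ad db]; rewrite le_eqVlt => /predU1P[->//|cd].
rewrite leNgt; apply/negP => Wdc.
(* Adding [k x] makes up only half of the drop from [W c] to [W d], so the perturbed function still
   has a smaller value at [d] than at [c] and its maximum lies strictly left of [d]. *)
pose k := (W c - W d) / (2 * (d - c)).
have dc0 : 0 < d - c by rewrite subr_gt0.
have k0 : 0 < k by rewrite divr_gt0 ?subr_gt0// mulr_gt0.
pose Wk := W \+ (fun x => k * x).
have cWk : {within `[a, b], continuous Wk}.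
  apply: within_itv_continuousD => //; apply: within_itv_continuousM.
    exact: within_itv_continuous_cst.
  exact: within_itv_continuous_id.
have cWkcd : {within `[c, d], continuous Wk}.
  by apply: continuous_subspaceW cWk; exact: subset_itvScc.
have [x xcd Wkx] := EVT_max (ltW cd) cWkcd.
have Wkdc : Wk d < Wk c.
  rewrite -subr_gt0 (_ : _ - _ = (W c - W d) / 2); first by rewrite divr_gt0 ?subr_gt0.
  by rewrite /Wk /k /=; field; rewrite gt_eqF.
have xltd : x < d.
  rewrite lt_neqAle; move: (xcd); rewrite in_itv/= => /andP[_ ->]; rewrite andbT.
  apply/eqP => xd; have := Wkx c; rewrite in_itv/= lexx (ltW cd) => /(_ isT).
  by rewrite xd leNgt Wkdc.
move: (xcd); rewrite in_itv/= => /andP[cx xd].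
have xab : x \in `[a, b] by rewrite in_itv/= (le_trans ac) ?(le_trans xd).
have xb : x < b := lt_le_trans xltd db.
have xb0 : 0 < b - x by rewrite subr_gt0.
have cid : {within `[0, b - x], continuous (fun t => k * t)}.
  apply: within_itv_continuousM; first exact: within_itv_continuous_cst.
  exact: within_itv_continuous_id.
have := lap_geD (within_itv_continuous_incr cW xab) cid ((HW x xab).1 xb)
  (lap_ge_linear k xb0).
rewrite add0r => /lap_ge_le0 k_le0.
suff : k <= 0 by rewrite leNgt k0.
apply: (k_le0 (d - x)).
- by apply: within_itv_continuousD => //; exact: within_itv_continuous_incr.
- by rewrite subr_gt0.
- by rewrite lerD2r.
- move=> t; rewrite in_itv/= => /andP[t0 tdx].
  have : Wk (x + t) <= Wk x by apply: Wkx; rewrite in_itv/=; apply/andP; split; lra.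
  rewrite /Wk /=; lra.
Qed.

(** [U - V] is a major function of [f - f = 0], hence nondecreasing. *)
Lemma laplace_major_minor_increment a b f U V : a < b ->
  laplace_major a b f U -> laplace_minor a b f V ->
  forall c d, c \in `[a, b] -> d \in `[a, b] -> c <= d -> V d - V c <= U d - U c.
Proof.
move=> ab HU HV c d cab dab cd.
have H : laplace_major a b (fun=> 0) (U \- V).
  apply: laplace_majorW (laplace_majorB ab HU HV) => x _ /=; by rewrite subrr.
have := laplace_major0_nondecreasing ab H cab dab cd => /=; lra.
Qed.

End LaplaceMajor.

(** * The Laplace integral *)
Section LaplaceIntegral.
Context {R : realType}.
Implicit Types (a b x s t I J : R) (f g U V W : R -> R).

(** The bounds over all major and all minor functions come for free: an arbitrary minor function is
    compared with a nearly optimal major one, and conversely. *)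
Lemma laplace_integral_intro a b f I : a < b ->
  (forall e : R, 0 < e -> exists U V, [/\ laplace_major a b f U, laplace_minor a b f V,
    I - e < V b - V a & U b - U a < I + e]) ->
  laplace_integral a b f I.
Proof.
move=> ab H.
have VU U V : laplace_major a b f U -> laplace_minor a b f V -> V b - V a <= U b - U a.
  move=> HU HV; apply: (laplace_major_minor_increment ab HU HV); last exact: ltW.
    by rewrite in_itv/= lexx ltW.
  by rewrite in_itv/= lexx ltW.
split=> [V HV|].
  apply/ler_addgt0Pr => e /H[U [_ [HU _ _ UI]]].
  by rewrite (le_trans (VU _ _ HU HV))// ltW.
split=> [e /H[U [V [_ HV IV _]]]|]; first by exists V.
split=> [U HU|e /H[U [V [HU _ _ UI]]]]; last by exists U.
apply/ler_addgt0Pr => e /H[_ [V [_ HV IV _]]].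
by have := VU _ _ HU HV; lra.
Qed.

(** For use when no value is known in advance: the supremum of the increments of minor functions is
    the integral. *)
Lemma laplace_integral_gap a b f : a < b ->
  (forall e : R, 0 < e -> exists U V, [/\ laplace_major a b f U, laplace_minor a b f V &
    (U b - U a) - (V b - V a) < e]) ->
  laplace_integrable a b f.
Proof.
move=> ab H.
have aab : a \in `[a, b] by rewrite in_itv/= lexx ltW.
have bab : b \in `[a, b] by rewrite in_itv/= lexx ltW.
have VU U V : laplace_major a b f U -> laplace_minor a b f V -> V b - V a <= U b - U a.
  by move=> HU HV; apply: (laplace_major_minor_increment ab HU HV) => //; exact: ltW.
pose S := [set V b - V a | V in laplace_minor a b f].
have supS : has_sup S.
  have [U [V [HU HV _]]] := H 1 ltr01; split; first by exists (V b - V a), V.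
  by exists (U b - U a) => _ [V' HV' <-]; exact: VU.
exists (sup S); apply: laplace_integral_intro => // e e0.
have [U [V [HU HV UV]]] := H e e0; exists U, V; split=> //.
  have : sup S <= U b - U a.
    by apply: ge_sup; [case: supS|move=> _ [V' HV' <-]; exact: VU].
  lra.
have : V b - V a <= sup S by apply: ub_le_sup; [case: supS|exists V].
lra.
Qed.

Lemma laplace_integral_le a b f I J :
  laplace_integral a b f I -> laplace_integral a b f J -> I <= J.
Proof.
move=> [_ [HI _]] [HJ _]; apply/ler_addgt0Pr => e /HI[V [/HJ]]; lra.
Qed.

Lemma lapintE a b f I : laplace_integral a b f I -> lapint a b f = I.
Proof.
move=> HI; apply: xget_unique => //= J HJ.
by apply/eqP; rewrite eq_le !(@laplace_integral_le a b f).
Qed.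

(** An integral over a point is squeezed by increments [U a - U a = 0]; without one, [xget] returns
    its default, again 0. This settles [x = a], where restriction to [[a, x]] with [a < x] does not
    apply. *)
Lemma lapint_set1 a f : lapint a a f = 0.
Proof.
rewrite /lapint; case: xgetP => // I -> [_ [Hm [_ HM]]].
apply/eqP; rewrite eq_le; apply/andP; split.
  by apply/ler_addgt0Pr => e /Hm[V [_]]; rewrite subrr; lra.
by apply/ler_addgt0Pr => e /HM[U [_]]; rewrite subrr; lra.
Qed.

Lemma laplace_integral_approx a b f I (e : R) : laplace_integral a b f I -> 0 < e ->
  exists U V, [/\ laplace_major a b f U, laplace_minor a b f V,
    I - e < V b - V a & U b - U a < I + e].
Proof.
move=> [_ [Hm [_ HM]]] e0; have [V [HV IV]] := Hm e e0; have [U [HU UI]] := HM e e0.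
by exists U, V.
Qed.

Lemma laplace_integrable_gap a b f (e : R) : laplace_integrable a b f -> 0 < e ->
  exists U V, [/\ laplace_major a b f U, laplace_minor a b f V &
    (U b - U a) - (V b - V a) < e].
Proof.
move=> [I HI] e0; have e20 : 0 < e / 2 by rewrite divr_gt0.
have [U [V [HU HV IV UI]]] := laplace_integral_approx HI e20.
by exists U, V; split=> //; lra.
Qed.

(** The gap over [[a, b]] is the sum of the gaps over [[a, x]] and [[x, b]], and the latter is
    nonnegative. *)
Lemma laplace_integrable_restrict a b x f : a < x -> x <= b ->
  laplace_integrable a b f -> laplace_integrable a x f.
Proof.
move=> ax xb intf; have ab := lt_le_trans ax xb.
apply: laplace_integral_gap => // e e0.
have [U [V [HU HV UV]]] := laplace_integrable_gap intf e0.
exists U, V; split.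
- exact: laplace_major_restrict HU.
- exact: laplace_minor_restrict HV.
- have := laplace_major_minor_increment ab HU HV (c := x) (d := b).
  rewrite !in_itv/= lexx (ltW ax) xb (ltW ab) => /(_ isT isT isT); lra.
Qed.

Lemma lapint_le_major a b x f U : laplace_integrable a b f -> x \in `[a, b] -> 
  laplace_major a b f U -> lapint a x f <= U x - U a.
Proof.
rewrite in_itv/= => intf /andP[]; rewrite le_eqVlt => /predU1P[<- _ _|ax xb HU].
  by rewrite lapint_set1 subrr.
have [I HI] := laplace_integrable_restrict ax xb intf; rewrite (lapintE HI).
by case: HI => _ [_ [+ _]]; apply; exact: laplace_major_restrict HU.
Qed.

Lemma minor_le_lapint a b x f V : laplace_integrable a b f -> x \in `[a, b] -> 
  laplace_minor a b f V -> V x - V a <= lapint a x f.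
Proof.
rewrite in_itv/= => intf /andP[]; rewrite le_eqVlt => /predU1P[<- _ _|ax xb HV].
  by rewrite lapint_set1 subrr.
have [I HI] := laplace_integrable_restrict ax xb intf; rewrite (lapintE HI).
by case: HI => + _; apply; exact: laplace_minor_restrict HV.
Qed.

(** Monotonicity of [U - V] turns closeness of the total increments into closeness to the indefinite
    integral that is uniform in [x]. *)
Lemma major_minor_gap_le a b x f U V : a < b -> x \in `[a, b] ->
  laplace_major a b f U -> laplace_minor a b f V ->
  (U x - U a) - (V x - V a) <= (U b - U a) - (V b - V a).
Proof.
move=> ab xab HU HV; have /andP[ax xb] : a <= x <= b by rewrite in_itv in xab.
have := laplace_major_minor_increment ab HU HV (c := x) (d := b).
rewrite xab in_itv/= lexx (ltW ab) xb => /(_ isT isT isT); lra.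
Qed.

(** The indefinite integral is a uniform limit of the continuous functions [U - U a]. *)
Lemma lapint_continuous a b f : a < b -> laplace_integrable a b f ->
  {within `[a, b], continuous (fun x => lapint a x f)}.
Proof.
move=> ab intf; apply/within_itv_continuousP => x xab e e0.
have e40 : 0 < e / 4 by rewrite divr_gt0.
have [U [V [HU HV UV]]] := laplace_integrable_gap intf e40.
have [/within_itv_continuousP cU _] := HU.
have [d d0 Hd] := cU x xab _ e40; exists d => // y yab yx.
have := Hd y yab yx.
have := lapint_le_major intf xab HU; have := minor_le_lapint intf xab HV.
have := lapint_le_major intf yab HU; have := minor_le_lapint intf yab HV.
have := major_minor_gap_le ab xab HU HV; have := major_minor_gap_le ab yab HU HV.
rewrite !ltr_norml => ? ? ? ? ? ? /andP[? ?]; apply/andP; split; lra.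
Qed.

(** Needed because the identities between primitives are established on [[a, b]] only, so integrands
    cannot be exchanged as functions. *)
Lemma eq_laplace_integral a b f g I : {in `[a, b], f =1 g} ->
  laplace_integral a b f I -> laplace_integral a b g I.
Proof.
move=> fg.
have maj U : laplace_major a b g U <-> laplace_major a b f U.
  by split=> HU; apply: laplace_majorW HU => x xab; rewrite fg.
have min V : laplace_minor a b g V <-> laplace_minor a b f V.
  by split=> -[cV HV]; split=> // x xab; have [? ?] := HV x xab; rewrite ?fg// -fg.
move=> [H1 [H2 [H3 H4]]]; split=> [V /min/H1//|]; split.
  by move=> e /H2[V [/min ? ?]]; exists V.
by split=> [U /maj/H3//|e /H4[U [/maj ? ?]]]; exists U.
Qed.

Lemma laplace_integralB a b f g I J : a < b -> laplace_integral a b f I ->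
  laplace_integral a b g J -> laplace_integral a b (f \- g) (I - J).
Proof.
move=> ab HI HJ; apply: laplace_integral_intro => // e e0.
have e20 : 0 < e / 2 by rewrite divr_gt0.
have [U [V [HU HV IV UI]]] := laplace_integral_approx HI e20.
have [U' [V' [HU' HV' IV' UI']]] := laplace_integral_approx HJ e20.
exists (U \- V'), (V \- U'); split.
- exact: laplace_majorB.
- exact: laplace_minorB.
- rewrite /=; lra.
- rewrite /=; lra.
Qed.

End LaplaceIntegral.

(** * Indefinite Lebesgue integrals *)
Section IndefiniteIntegral.
Context {R : realType}.
Notation mu := (@lebesgue_measure R).
Implicit Types (a b c d x y z t k C D h : R) (f g phi psi U V : R -> R).

Lemma integrable_itvS a b y z phi : mu.-integrable `[a, b] (EFin \o phi) ->
  y \in `[a, b] -> z \in `[a, b] -> mu.-integrable `[y, z] (EFin \o phi).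
Proof.
rewrite !in_itv/= => iphi /andP[ay _] /andP[_ zb]; apply: integrableS iphi => //.
by apply: subset_itvScc.
Qed.

Lemma Rintegral_increment_le a b phi D y z : mu.-integrable `[a, b] (EFin \o phi) ->
  y \in `[a, b] -> z \in `[a, b] -> y <= z ->
  (forall x, x \in `[y, z] -> phi x <= D) ->
  Rintegral mu `[a, z] phi - Rintegral mu `[a, y] phi <= D * (z - y).
Proof.
move=> iphi yab zab yz phiD.
have aab : a \in `[a, b].
  by move: yab; rewrite !in_itv/= lexx => /andP[]; exact: le_trans.
have ay : a <= y by move: yab; rewrite in_itv => /andP[].
rewrite (@Rintegral_itvB _ _ (BLeft a) (BRight z) y) ?bnd_simp//; last first.
  exact: integrable_itvS iphi _ _.
apply: (@le_trans _ _ (Rintegral mu `]y, z] (fun=> D))).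
  apply: le_Rintegral => //=.
  - apply: (@integrableS _ _ _ mu `[y, z]) => //; first exact: subset_itv_oc_cc.
    exact: integrable_itvS iphi _ _.
  - apply: (@integrableS _ _ _ mu `[y, z]) => //; first exact: subset_itv_oc_cc.
    by apply: within_itv_integrable; exact: within_itv_continuous_cst.
  - by move=> x xyz; apply: phiD; exact: subset_itv_oc_cc xyz.
rewrite Rintegral_cst//= lebesgue_measure_itv/= lte_fin.
by move: yz; rewrite le_eqVlt => /predU1P[->|->//]; rewrite ltxx subrr.
Qed.

Lemma integrableN_EFin (A : set R) phi : mu.-integrable A (EFin \o phi) ->
  mu.-integrable A (EFin \o (\- phi)).
Proof. by move=> iphi; exact: (integrableN iphi). Qed.

Lemma Rintegral_increment_ge a b phi D y z : mu.-integrable `[a, b] (EFin \o phi) ->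
  y \in `[a, b] -> z \in `[a, b] -> y <= z ->
  (forall x, x \in `[y, z] -> D <= phi x) ->
  D * (z - y) <= Rintegral mu `[a, z] phi - Rintegral mu `[a, y] phi.
Proof.
move=> iphi yab zab yz phiD.
have aab : a \in `[a, b].
  by move: yab; rewrite !in_itv/= lexx => /andP[]; exact: le_trans.
have NE x : x \in `[a, b] ->
    Rintegral mu `[a, x] (\- phi) = - Rintegral mu `[a, x] phi.
  move=> xab; rewrite -[RHS]mulN1r -RintegralZl//=; last exact: integrable_itvS iphi _ _.
  by apply: eq_Rintegral => t _; rewrite mulN1r.
have := Rintegral_increment_le (D := - D) (integrableN_EFin iphi) yab zab yz.
rewrite !NE// => /(_ _); suff H x : x \in `[y, z] -> (\- phi) x <= - D.
  by move=> /(_ H); lra.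
by move=> xyz; rewrite /= lerN2 phiD.
Qed.

Lemma Rintegral_increment_norm_le a b phi D y z :
  mu.-integrable `[a, b] (EFin \o phi) ->
  y \in `[a, b] -> z \in `[a, b] -> y <= z ->
  (forall x, x \in `[y, z] -> `|phi x| <= D) ->
  `|Rintegral mu `[a, z] phi - Rintegral mu `[a, y] phi| <= D * (z - y).
Proof.
move=> iphi yab zab yz phiD.
have phi_bounds x : x \in `[y, z] -> - D <= phi x <= D.
  by move=> /phiD; rewrite ler_norml.
rewrite ler_norml; apply/andP; split.
  rewrite -mulNr; apply: (Rintegral_increment_ge iphi) => // x /phi_bounds.
  by case/andP.
by apply: (Rintegral_increment_le iphi) => // x /phi_bounds/andP[].
Qed.

Lemma within_itv_continuous_int a b phi : a <= b ->
  mu.-integrable `[a, b] (EFin \o phi) ->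
  {within `[a, b], continuous (fun x => Rintegral mu `[a, x] phi)}.
Proof. by move=> ab iphi; exact: parameterized_integral_continuous. Qed.

(* [M y - M x - G x (U y - U x)] is the integral of [(U y - U) g] from [x]
   to [y], which is [o(y - x)] because [U] is continuous and [g] bounded. *)
Lemma by_parts_increment a b U g C : {within `[a, b], continuous U} ->
  measurable_fun `[a, b] g -> (forall x, x \in `[a, b] -> `|g x| <= C) ->
  let G x := Rintegral mu `[a, x] g in
  let M x := U x * G x - Rintegral mu `[a, x] (U \* g) in
  forall x h, x \in `[a, b] -> 0 < h -> exists2 d : R, 0 < d &
    forall y, y \in `[a, b] -> `|y - x| < d ->
      `|M y - M x - G x * (U y - U x)| <= h * `|y - x|.
Proof.
move=> cU mg gC G M x h xab h0.
have aab : a \in `[a, b].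
  by move: xab; rewrite !in_itv/= lexx => /andP[]; exact: le_trans.
have C0 : 0 <= C by exact: le_trans (gC x xab).
have ig : mu.-integrable `[a, b] (EFin \o g) by exact: bounded_integrable gC.
have iUg := continuousM_integrable cU mg gC.
(* Between [x] and [y] the values of [U] differ by at most [2 eta] and [g] is at most [C] in
   absolute value, so the integrand stays below [h]; the [+ 1] covers [C = 0]. *)
pose eta := h / (2 * (C + 1)).
have C10 : 0 < C + 1 by rewrite ltr_wpDl.
have eta0 : 0 < eta by rewrite divr_gt0// mulr_gt0.
have etaC : 2 * eta * C <= h.
  have -> : 2 * eta * C = h * (C / (C + 1)) by rewrite /eta; field; rewrite gt_eqF.
  by rewrite ler_piMr ?(ltW h0)// ler_pdivrMr// mul1r lerDl.
have [d d0 Ud] := (within_itv_continuousP _ _ _).1 cU x xab eta eta0.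
exists d => // y yab yx.
have ick (k : R) : mu.-integrable `[a, b] (EFin \o (cst k \* g)).
  by apply: continuousM_integrable mg gC; exact: within_itv_continuous_cst.
have ikU (k : R) : mu.-integrable `[a, b] (EFin \o (fun t => k * g t - U t * g t)).
  by have /= := integrableB _ (ick k) iUg; exact.
(* Used with [k = U y] on [[x, y]] or [[y, x]]: the expression is then, up to sign,
   [M y - M x - G x (U y - U x)]. *)
have est (k p q : R) : p \in `[a, b] -> q \in `[a, b] -> p <= q ->
    (forall t, t \in `[p, q] -> `|k - U t| <= 2 * eta) ->
    `|k * (G q - G p) - (Rintegral mu `[a, q] (U \* g) - Rintegral mu `[a, p] (U \* g))|
      <= h * (q - p).
  move=> pab qab pq kU.
  have E t : t \in `[a, b] -> Rintegral mu `[a, t] (fun t => k * g t - U t * g t) =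
      k * G t - Rintegral mu `[a, t] (U \* g).
    move=> tab; rewrite RintegralB//=.
    - by rewrite RintegralZl//=; exact: integrable_itvS ig _ _.
    - exact: integrable_itvS (ick k) _ _.
    - exact: integrable_itvS iUg _ _.
  have : `|Rintegral mu `[a, q] (fun t => k * g t - U t * g t) -
      Rintegral mu `[a, p] (fun t => k * g t - U t * g t)| <= h * (q - p).
    apply: (Rintegral_increment_norm_le (ikU k)) => // t tpq.
    have tab : t \in `[a, b].
      move: tpq pab qab; rewrite !in_itv/= => /andP[pt tq] /andP[ap _] /andP[_ qb].
      by rewrite (le_trans ap pt) (le_trans tq qb).
    rewrite -mulrBl normrM (le_trans _ etaC)//.
    by apply: ler_pM => //; [exact: kU|exact: gC].
  by rewrite !E//; congr (`|_| <= _); ring.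
have near2 t : t \in `[a, b] -> `|t - x| <= `|y - x| -> `|U y - U t| <= 2 * eta.
  move=> tab tx; have := Ud y yab yx; have := Ud t tab (le_lt_trans tx yx).
  by rewrite !ltr_norml ler_norml => /andP[? ?] /andP[? ?]; apply/andP; split; lra.
have [yltx|xley] := ltP y x.
  have := est (U y) y x yab xab (ltW yltx).
  have -> : `|y - x| = x - y by rewrite distrC gtr0_norm ?subr_gt0.
  move=> H; rewrite -normrN; apply: le_trans (H _).
    by rewrite le_eqVlt; apply/orP; left; apply/eqP; congr (`|_|); rewrite /M; ring.
  move=> t; rewrite in_itv/= => /andP[yt tx]; apply: near2.
    move: yab xab; rewrite !in_itv/= => /andP[ay _] /andP[_ xb].
    by rewrite (le_trans ay yt) (le_trans tx xb).
  by rewrite !ler0_norm ?subr_le0 ?(ltW yltx)//; lra.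
have := est (U y) x y xab yab xley.
rewrite [`|y - x|]ger0_norm ?subr_ge0// => H; apply: le_trans (H _).
  by rewrite le_eqVlt; apply/orP; left; apply/eqP; congr (`|_|); rewrite /M; ring.
move=> t; rewrite in_itv/= => /andP[xt ty]; apply: near2.
  move: yab xab; rewrite !in_itv/= => /andP[_ yb] /andP[ax _].
  by rewrite (le_trans ax xt) (le_trans ty yb).
by rewrite !ger0_norm ?subr_ge0//; lra.
Qed.

Lemma laplace_major_by_parts a b f U g C : a < b -> laplace_major a b f U ->
  measurable_fun `[a, b] g -> (forall x, x \in `[a, b] -> 0 <= g x <= C) ->
  let G x := Rintegral mu `[a, x] g in
  laplace_major a b (fun x => f x * G x)
    (fun x => U x * G x - Rintegral mu `[a, x] (U \* g)).
Proof.
move=> ab /(laplace_majorP _ _ ab)[cU HU] mg g0C G.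
have gC x : x \in `[a, b] -> `|g x| <= C.
  by move=> /g0C/andP[g0 ?]; rewrite ger0_norm.
have ig : mu.-integrable `[a, b] (EFin \o g) by exact: bounded_integrable gC.
have iUg := continuousM_integrable cU mg gC.
have cM : {within `[a, b], continuous (fun x => U x * G x - Rintegral mu `[a, x] (U \* g))}.
  apply: within_itv_continuousB; last exact: within_itv_continuous_int (ltW ab) iUg.
  by apply: within_itv_continuousM => //; exact: within_itv_continuous_int (ltW ab) ig.
have incr := by_parts_increment cU mg gC.
apply/laplace_majorP => //; split=> // x xab.
have [HUr HUl] := HU x xab.
have /andP[ax xb] : a <= x <= b by rewrite in_itv in xab.
(* This sign lets the lower bound on the derivates of [U] be multiplied by [G x]. *)
have Gx0 : 0 <= G x.
  apply: Rintegral_ge0 => t; rewrite /= in_itv/= => /andP[at_ tx].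
  suff tab : t \in `[a, b] by have /andP[] := g0C t tab.
  by rewrite in_itv/= at_ (le_trans tx).
rewrite (mulrC (f x)); split.
  move=> xltb; apply: (lap_ge_by_increment _ Gx0 _ _ (HUr xltb)).
  - by rewrite subr_gt0.
  - exact: within_itv_continuous_incr.
  - by have := within_itv_continuous_incr cM xab.
  - move=> h h0; have [r r0 Hr] := incr x h xab h0; exists r => // t.
    rewrite in_itv/= => /andP[t0 tbx] tr.
    have yab : x + t \in `[a, b] by rewrite in_itv/=; apply/andP; split; lra.
    have := Hr _ yab; rewrite [x + t]addrC addrK (ger0_norm t0) => /(_ tr).
    by rewrite ler_norml -/(G _) => /andP[+ _]; rewrite -/(G x); lra.
move=> altx; apply: (lap_ge_by_increment _ Gx0 _ _ (HUl altx)).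
- by rewrite subr_gt0.
- exact: within_itv_continuous_decr.
- by have := within_itv_continuous_decr cM xab.
- move=> h h0; have [r r0 Hr] := incr x h xab h0; exists r => // t.
  rewrite in_itv/= => /andP[t0 tbx] tr.
  have yab : x - t \in `[a, b] by rewrite in_itv/=; apply/andP; split; lra.
  have := Hr _ yab; rewrite [x - t]addrC addrK normrN (ger0_norm t0) => /(_ tr).
  by rewrite ler_norml -/(G _) => /andP[_ +]; rewrite -/(G x); lra.
Qed.

End IndefiniteIntegral.

(** * Integration by parts against a Lebesgue primitive *)
Section LaplaceByParts.
Context {R : realType}.
Notation mu := (@lebesgue_measure R).
Implicit Types (a b x y z t k C D h e : R) (f g phi U V W F : R -> R).

(** [M a] is 0. In [M b], bound [W b] above by [W a + F b + e] and, under the integral, [W] below by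
    [W a + F]; the contributions of [W a] cancel. A general [W] covers both [U] with [F] and [- V]
    with [- F]. *)
Lemma by_parts_value_le a b W F g C e : a <= b ->
  {within `[a, b], continuous W} -> {within `[a, b], continuous F} ->
  measurable_fun `[a, b] g -> (forall x, x \in `[a, b] -> 0 <= g x <= C) ->
  (forall x, x \in `[a, b] -> 0 <= W x - W a - F x <= e) ->
  let G x := Rintegral mu `[a, x] g in
  let M x := W x * G x - Rintegral mu `[a, x] (W \* g) in
  is_true (M b - M a <= F b * G b - Rintegral mu `[a, b] (F \* g) + e * G b).
Proof.
move=> ab cW cF mg g0C WF G M.
have gC x : x \in `[a, b] -> `|g x| <= C.
  by move=> /g0C/andP[g0 ?]; rewrite ger0_norm.
have ig : mu.-integrable `[a, b] (EFin \o g) by exact: bounded_integrable gC.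
have iWg := continuousM_integrable cW mg gC.
have iFg := continuousM_integrable cF mg gC.
have iag := continuousM_integrable (@within_itv_continuous_cst _ a b (W a)) mg gC.
have Ga : G a = 0 by rewrite /G set_itv1 Rintegral_set1.
have Gb0 : 0 <= G b.
  by apply: Rintegral_ge0 => t /g0C/andP[].
have -> : M a = 0 by rewrite /M Ga mulr0 set_itv1 Rintegral_set1 subr0.
have intE : W a * G b + Rintegral mu `[a, b] (F \* g) <= Rintegral mu `[a, b] (W \* g).
  rewrite /G -RintegralZl// -RintegralD//=.
  apply: le_Rintegral => //=.
    by have /= := integrableD _ iag iFg; exact.
  move=> t tab; rewrite -mulrDl; apply: ler_wpM2r; first by have /andP[] := g0C t tab.
  by have := WF t tab; lra.
have bab : b \in `[a, b] by rewrite in_itv/= lexx ab.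
have /andP[_ WFb] := WF b bab.
have : (W b - W a - F b) * G b <= e * G b by exact: ler_wpM2r.
rewrite /M subr0 !mulrBl; lra.
Qed.

Lemma laplace_integral_by_parts_ge0 a b f g C : a < b -> laplace_integrable a b f ->
  measurable_fun `[a, b] g -> (forall x, x \in `[a, b] -> 0 <= g x <= C) ->
  let F x := lapint a x f in
  let G x := Rintegral mu `[a, x] g in
  laplace_integral a b (fun x => f x * G x)
    (F b * G b - Rintegral mu `[a, b] (F \* g)).
Proof.
move=> ab intf mg g0C F G; apply: laplace_integral_intro => // e e0.
have cF : {within `[a, b], continuous F} by exact: lapint_continuous.
have Gb0 : 0 <= G b by apply: Rintegral_ge0 => t /g0C/andP[].
have Gb1 : 0 < G b + 1 by rewrite ltr_wpDl.
(* A gap [h] costs [h * G b < e] in the value; [G b] itself may be 0. *)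
pose h := e / (G b + 1).
have h0 : 0 < h by rewrite divr_gt0.
have hG : h * G b < e.
  rewrite /h mulrAC -mulrA gtr_pMr// ltr_pdivrMr//; lra.
have [U [V [HU HV UV]]] := laplace_integrable_gap intf h0.
have gapx x : x \in `[a, b] ->
    0 <= U x - U a - F x <= h /\ 0 <= - V x - - V a - - F x <= h.
  move=> xab; have := major_minor_gap_le ab xab HU HV.
  have := lapint_le_major intf xab HU; have := minor_le_lapint intf xab HV.
  by rewrite -/(F x) => ? ? ?; split; apply/andP; split; lra.
have HNV := (laplace_minorN _ _ ab).1 HV.
have [cU _] := HU; have [cNV _] := HNV.
have cNF := within_itv_continuousN cF.
pose M W x := W x * G x - Rintegral mu `[a, x] (W \* g).
(* The minor function is the reflection of the construction applied to the major function [- V] of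
   [- f]. *)
exists (M U), (\- M (\- V)); split.
- exact: laplace_major_by_parts HU mg g0C.
- apply/(laplace_minorN _ _ ab).
  have -> : \- (\- M (\- V)) = M (\- V) by apply/funext => x; exact: opprK.
  have -> : \- (fun x => f x * G x) = (fun x => (\- f) x * G x).
    by apply/funext => x; exact: esym (mulNr _ _).
  exact: laplace_major_by_parts HNV mg g0C.
- have Hle : M (\- V) b - M (\- V) a <=
      - F b * G b - Rintegral mu `[a, b] (\- F \* g) + h * G b.
    exact: by_parts_value_le (ltW ab) cNV cNF mg g0C (fun x xab => (gapx x xab).2).
  have NFg : Rintegral mu `[a, b] (\- F \* g) = - Rintegral mu `[a, b] (F \* g).
    rewrite -[RHS]mulN1r -RintegralZl//=.
      by apply: eq_Rintegral => t _; rewrite mulN1r mulNr.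
    apply: (continuousM_integrable cF mg (C := C)) => x /g0C/andP[g0 ?].
    by rewrite ger0_norm.
  by move: Hle; rewrite NFg mulNr /=; lra.
- have : M U b - M U a <= F b * G b - Rintegral mu `[a, b] (F \* g) + h * G b.
    exact: by_parts_value_le (ltW ab) cU cF mg g0C (fun x xab => (gapx x xab).1).
  lra.
Qed.

(* Write [g] as [(g + C) - C]. *)
Lemma laplace_integral_by_parts a b f g C : a < b -> laplace_integrable a b f ->
  measurable_fun `[a, b] g -> (forall x, x \in `[a, b] -> `|g x| <= C) ->
  let F x := lapint a x f in
  let G x := Rintegral mu `[a, x] g in
  laplace_integral a b (fun x => f x * G x)
    (F b * G b - Rintegral mu `[a, b] (F \* g)).
Proof.
move=> ab intf mg gC F G.
have aab : a \in `[a, b] by rewrite in_itv/= lexx ltW.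
have bab : b \in `[a, b] by rewrite in_itv/= lexx ltW.
have C0 : 0 <= C by exact: le_trans (gC a aab).
have cF : {within `[a, b], continuous F} by exact: lapint_continuous.
have ig : mu.-integrable `[a, b] (EFin \o g) by exact: bounded_integrable gC.
have mC : measurable_fun `[a, b] (cst C : R -> R) by exact: measurable_cst.
have iC : mu.-integrable `[a, b] (EFin \o cst C).
  by apply: within_itv_integrable; exact: within_itv_continuous_cst.
have mgC : measurable_fun `[a, b] (g \+ cst C) by exact: measurable_funD.
have H1 : forall x, x \in `[a, b] -> 0 <= (g \+ cst C) x <= 2 * C.
  move=> x /gC; rewrite ler_norml /= => /andP[? ?]; apply/andP; split; lra.
have H2 : forall x, x \in `[a, b] -> 0 <= (cst C : R -> R) x <= C.
  by move=> x _ /=; rewrite C0 lexx.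
have := laplace_integralB ab (laplace_integral_by_parts_ge0 ab intf mgC H1)
  (laplace_integral_by_parts_ge0 ab intf mC H2).
have GE x : x \in `[a, b] -> Rintegral mu `[a, x] (g \+ cst C) =
    G x + Rintegral mu `[a, x] (cst C).
  by move=> xab; rewrite RintegralD//=; apply: integrable_itvS aab xab.
have FE : Rintegral mu `[a, b] (F \* (g \+ cst C)) =
    Rintegral mu `[a, b] (F \* g) + Rintegral mu `[a, b] (F \* cst C).
  rewrite -RintegralD//=.
  - by apply: eq_Rintegral => t _; rewrite mulrDr.
  - exact: continuousM_integrable cF mg gC.
  - apply: (continuousM_integrable cF mC (C := C)) => x _ /=.
    by rewrite ger0_norm.
rewrite FE (GE b bab) -/F -/(F b) => H.
have -> : F b * G b - Rintegral mu `[a, b] (F \* g) =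
  F b * (G b + Rintegral mu `[a, b] (cst C)) -
     (Rintegral mu `[a, b] (F \* g) + Rintegral mu `[a, b] (F \* cst C)) -
    (F b * Rintegral mu `[a, b] (cst C) - Rintegral mu `[a, b] (F \* cst C)) by ring.
by apply: eq_laplace_integral H => x xab /=; rewrite GE//; ring.
Qed.

End LaplaceByParts.

(** * Perron integral and primitives of continuous functions *)
Section Perron.
Context {R : realType}.
Notation mu := (@lebesgue_measure R).
Implicit Types (a b c d r s x y z t e : R) (f g h k phi U V W F H K : R -> R).

Lemma near_within_dnbhsP a b x (P : R -> Prop) :
  (\forall y \near within `[a, b] x^', P y) <->
  (exists2 d : R, 0 < d & forall y, y \in `[a, b] -> y != x -> `|y - x| < d -> P y).
Proof.
split.
  rewrite !near_withinE => -[d /= d0 dP]; exists d => // y yab yx yd.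
  by apply: dP => //=; rewrite distrC.
move=> [d d0 dP]; rewrite !near_withinE; exists d => //= y /= yd yx yab.
by apply: dP => //; rewrite distrC.
Qed.

Lemma perron_majorP a b f U x e : perron_major a b f U -> x \in `[a, b] -> 0 < e ->
  exists2 d : R, 0 < d & forall y, y \in `[a, b] -> y != x -> `|y - x| < d ->
    f x - e <= (U y - U x) / (y - x).
Proof.
move=> HU xab e0; have [+ _] := HU x xab.
by rewrite limf_einf_ge => /(_ e e0)/near_within_dnbhsP.
Qed.

Lemma perron_minorP a b f V x e : perron_minor a b f V -> x \in `[a, b] -> 0 < e ->
  exists2 d : R, 0 < d & forall y, y \in `[a, b] -> y != x -> `|y - x| < d ->
    (V y - V x) / (y - x) <= f x + e.
Proof.
move=> HV xab e0; have [+ _] := HV x xab.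
by rewrite limf_esup_le => /(_ e e0)/near_within_dnbhsP.
Qed.

Lemma perron_major_minor_le a b f U V : a < b ->
  perron_major a b f U -> perron_minor a b f V -> V b - V a <= U b - U a.
Proof.
move=> ab HU HV; pose W := U \- V.
have loc x (k : R) : x \in `[a, b] -> 0 < k -> exists2 d : R, 0 < d &
    forall y, y \in `[a, b] -> `|y - x| < d ->
    (x <= y -> - k * (y - x) <= W y - W x) /\ (y <= x -> - k * (x - y) <= W x - W y).
  move=> xab k0; have k20 : 0 < k / 2 by rewrite divr_gt0.
  have [d d0 Hd] := perron_majorP HU xab k20.
  have [d' d'0 Hd'] := perron_minorP HV xab k20.
  exists (Num.min d d'); first by rewrite lt_min d0.
  move=> y yab; rewrite lt_min => /andP[yd yd'].
  have [->|yx] := eqVneq y x; first by rewrite !subrr mulr0 lexx.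
  have := Hd y yab yx yd; have := Hd' y yab yx yd'.
  have [xy|xy] := ltP x y.
    rewrite ler_pdivlMr ?ler_pdivrMr ?subr_gt0// => ? ?.
    split=> [_|//].
    rewrite /W /=; nra.
  have {}xy : y < x by rewrite lt_neqAle yx.
  rewrite ler_ndivlMr ?ler_ndivrMr ?subr_lt0// => ? ?.
  split=> [yx'|_]; first by move: xy; rewrite ltNge yx'.
  rewrite /W /=; nra.
suff : W a <= W b by rewrite /W /=; lra.
(* Slope [- k] loses exactly [e] over the whole segment. *)
apply/ler_addgt0Pr => e e0; pose k := e / (b - a).
have ba0 : 0 < b - a by rewrite subr_gt0.
have k0 : 0 < k by rewrite divr_gt0.
have -> : e = k * (b - a) by rewrite divfK// gt_eqF.
pose S := [set x | x \in `[a, b] /\ W a - k * (x - a) <= W x].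
have Sa : S a by split; rewrite ?in_itv/= ?lexx ?(ltW ab)//; lra.
have supS : has_sup S.
  by split; [exists a|exists b => x [+ _]; rewrite in_itv => /andP[]].
pose c := sup S.
have ac : a <= c by apply: ub_le_sup => //; case: supS.
have cb : c <= b.
  by apply: ge_sup; [case: supS|move=> x [+ _]; rewrite in_itv => /andP[]].
have cab : c \in `[a, b] by rewrite in_itv/= ac.
have [d d0 Hd] := loc c k cab k0.
(* The left half of [loc] at [c], applied to a point of [S] close to [c], replaces continuity of
   [W]. *)
have Sc : W a - k * (c - a) <= W c.
  have [x Sx xc] := sup_adherent d0 supS.
  have xlec : x <= c by apply: ub_le_sup => //; case: supS.
  have [xab Wx] := Sx; have [|_ /(_ xlec)] := Hd x xab.
    by rewrite ltr_norml; apply/andP; split; rewrite -/c in xc; lra.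
  nra.
have [cltb|] := ltP c b; last first.
  by move=> bc; have <- : c = b by [apply/eqP; rewrite eq_le cb]; lra.
(* If [c < b], the right half of [loc] puts this [y > c] in [S], a contradiction. *)
pose y := Num.min (c + d / 2) b.
have cy : c < y by rewrite lt_min cltb andbT ltrDl divr_gt0.
have yb : y <= b by rewrite ge_min lexx orbT.
have ycd : y <= c + d / 2 by rewrite ge_min lexx.
have yab : y \in `[a, b] by rewrite in_itv/= yb (le_trans ac (ltW cy)).
have [|/(_ (ltW cy)) Wy _] := Hd y yab.
  by rewrite ltr_norml; apply/andP; split; lra.
have Sy : S y by split=> //; lra.
have : y <= c by apply: ub_le_sup => //; case: supS.
by rewrite leNgt cy.
Qed.

Lemma perron_integral_intro a b f (I : R) : a < b ->
  (forall e : R, 0 < e -> exists U V, [/\ perron_major a b f U, perron_minor a b f V,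
    I - e < V b - V a & U b - U a < I + e]) ->
  perron_integral a b f I.
Proof.
move=> ab HI.
split=> [V HV|].
  apply/ler_addgt0Pr => e /HI[U [_ [HU _ _ UI]]].
  by rewrite (le_trans (perron_major_minor_le ab HU HV))// ltW.
split=> [e /HI[U [V [_ HV IV _]]]|]; first by exists V.
split=> [U HU|e /HI[U [V [HU _ _ UI]]]]; last by exists U.
apply/ler_addgt0Pr => e /HI[_ [V [_ HV IV _]]].
by have := perron_major_minor_le ab HU HV; lra.
Qed.

(** Derivative relative to [[a, b]], hence one-sided at the endpoints. The form without quotient is
    the one that [lap_ge_by_increment] consumes. *)
Definition has_deriv_itv a b H h := forall x, x \in `[a, b] -> forall e, 0 < e ->
  exists2 d : R, 0 < d & forall y, y \in `[a, b] -> `|y - x| < d ->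
    `|H y - H x - h x * (y - x)| <= e * `|y - x|.

Lemma has_deriv_itvP a b H h x e : has_deriv_itv a b H h -> x \in `[a, b] -> 0 < e ->
  exists2 d : R, 0 < d & forall y, y \in `[a, b] -> y != x -> `|y - x| < d ->
    h x - e <= (H y - H x) / (y - x) <= h x + e.
Proof.
move=> Hh xab e0; have [d d0 Hd] := Hh x xab e e0; exists d => // y yab yx yd.
have yx0 : y - x != 0 by rewrite subr_eq0.
have : `|(H y - H x) / (y - x) - h x| <= e.
  have -> : (H y - H x) / (y - x) - h x = (H y - H x - h x * (y - x)) / (y - x).
    by field.
  by rewrite normrM normfV ler_pdivrMr ?normr_gt0//; exact: Hd.
by rewrite ler_norml => /andP[? ?]; apply/andP; split; lra.
Qed.

Lemma has_deriv_itv_perron_major a b f H h : has_deriv_itv a b H h ->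
  (forall x, x \in `[a, b] -> f x <= h x) -> perron_major a b f H.
Proof.
move=> Hh fh x xab.
have le_lower : ((h x)%:E <= lower_deriv a b H x)%E.
  apply/limf_einf_ge => e e0; apply/near_within_dnbhsP.
  have [d d0 Hd] := has_deriv_itvP Hh xab e0; exists d => // y yab yx yd.
  by have /andP[] := Hd y yab yx yd.
split; first by apply: le_trans le_lower; rewrite lee_fin fh.
by apply: lt_le_trans le_lower; exact: ltNyr.
Qed.

Lemma has_deriv_itv_perron_minor a b f H h : has_deriv_itv a b H h ->
  (forall x, x \in `[a, b] -> h x <= f x) -> perron_minor a b f H.
Proof.
move=> Hh hf x xab.
have upper_le : (upper_deriv a b H x <= (h x)%:E)%E.
  apply/limf_esup_le => e e0; apply/near_within_dnbhsP.
  have [d d0 Hd] := has_deriv_itvP Hh xab e0; exists d => // y yab yx yd.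
  by have /andP[] := Hd y yab yx yd.
split; first by apply: le_trans upper_le _; rewrite lee_fin hf.
by apply: le_lt_trans upper_le _; exact: ltry.
Qed.

(** Each of [H] and [K] is both a Perron major and a Perron minor function of [h], so the comparison
    applies in both directions. *)
Lemma has_deriv_itv_increment a b H K h : a < b ->
  has_deriv_itv a b H h -> has_deriv_itv a b K h -> H b - H a = K b - K a.
Proof.
move=> ab HH HK.
have hh x : x \in `[a, b] -> h x <= h x by [].
apply/eqP; rewrite eq_le; apply/andP; split; apply: (@perron_major_minor_le a b h) => //;
by [exact: has_deriv_itv_perron_major hh|exact: has_deriv_itv_perron_minor hh].
Qed.

Lemma has_deriv_itv_laplace_major a b f H h : a < b -> {within `[a, b], continuous H} ->
  has_deriv_itv a b H h -> (forall x, x \in `[a, b] -> f x <= h x) ->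
  laplace_major a b f H.
Proof.
move=> ab cH Hh fh; apply: (laplace_majorW fh).
apply/laplace_majorP => //; split=> // x xab.
have /andP[ax xb] : a <= x <= b by rewrite in_itv in xab.
have cid d : {within `[0, d], continuous (fun t => h x * t)}.
  apply: within_itv_continuousM; first exact: within_itv_continuous_cst.
  exact: within_itv_continuous_id.
rewrite -(mul1r (h x)); split=> [xltb|altx].
  have xb0 : 0 < b - x by rewrite subr_gt0.
  apply: (lap_ge_by_increment xb0 ler01 (cid _) _ (lap_ge_linear _ xb0)).
    exact: within_itv_continuous_incr.
  move=> e e0; have [d d0 Hd] := Hh x xab e e0; exists d => // t.
  rewrite in_itv/= => /andP[t0 tbx] td.
  have yab : x + t \in `[a, b] by rewrite in_itv/=; apply/andP; split; lra.
  have := Hd _ yab; rewrite [x + t]addrC addrK (ger0_norm t0) => /(_ td).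
  by rewrite ler_norml => /andP[+ _]; lra.
have ax0 : 0 < x - a by rewrite subr_gt0.
apply: (lap_ge_by_increment ax0 ler01 (cid _) _ (lap_ge_linear _ ax0)).
  exact: within_itv_continuous_decr.
move=> e e0; have [d d0 Hd] := Hh x xab e e0; exists d => // t.
rewrite in_itv/= => /andP[t0 tbx] td.
have yab : x - t \in `[a, b] by rewrite in_itv/=; apply/andP; split; lra.
have := Hd _ yab; rewrite [x - t]addrC addrK normrN (ger0_norm t0) => /(_ td).
by rewrite ler_norml => /andP[_ +]; lra.
Qed.

Lemma has_deriv_itvN a b H h : has_deriv_itv a b H h -> has_deriv_itv a b (\- H) (\- h).
Proof.
move=> Hh x xab e e0; have [d d0 Hd] := Hh x xab e e0; exists d => // y yab yd.
by rewrite -normrN; apply: le_trans (Hd y yab yd); rewrite le_eqVlt /=;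
  apply/orP; left; apply/eqP; congr (`|_|); ring.
Qed.

Lemma has_deriv_itvB a b H K h k : has_deriv_itv a b H h -> has_deriv_itv a b K k ->
  has_deriv_itv a b (H \- K) (h \- k).
Proof.
move=> Hh Kk x xab e e0; have e20 : 0 < e / 2 by rewrite divr_gt0.
have [d d0 Hd] := Hh x xab _ e20; have [d' d'0 Hd'] := Kk x xab _ e20.
exists (Num.min d d'); first by rewrite lt_min d0.
move=> y yab; rewrite lt_min => /andP[/(Hd y yab) + /(Hd' y yab)] /=.
by rewrite !ler_norml => /andP[? ?] /andP[? ?]; apply/andP; split; lra.
Qed.

Lemma has_deriv_itvZ a b r H h : has_deriv_itv a b H h ->
  has_deriv_itv a b (fun x => r * H x) (fun x => r * h x).
Proof.
move=> Hh x xab e e0; have r10 : 0 < `|r| + 1 by rewrite ltr_wpDl.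
have [d d0 Hd] := Hh x xab _ (divr_gt0 e0 r10); exists d => // y yab yd.
rewrite -mulrA -!mulrBr normrM; apply: le_trans (ler_wpM2l _ (Hd y yab yd)) _ => //.
rewrite mulrA ler_wpM2r// mulrCA ler_piMr ?(ltW e0)// ler_pdivrMr// mul1r lerDl//.
Qed.

Lemma has_deriv_itv_shift a b c d r H h : has_deriv_itv c d H h ->
  (forall x, x \in `[a, b] -> x + r \in `[c, d]) ->
  has_deriv_itv a b (fun x => H (x + r)) (fun x => h (x + r)).
Proof.
move=> Hh shift x xab e e0; have [s s0 Hs] := Hh _ (shift x xab) e e0.
exists s => // y yab; have := Hs _ (shift y yab).
by rewrite (_ : y + r - (x + r) = y - x); last by ring.
Qed.

Lemma has_deriv_itv_laplace_minor a b f H h : a < b -> {within `[a, b], continuous H} ->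
  has_deriv_itv a b H h -> (forall x, x \in `[a, b] -> h x <= f x) ->
  laplace_minor a b f H.
Proof.
move=> ab cH Hh hf; apply/laplace_minorN => //.
apply: (has_deriv_itv_laplace_major ab _ (has_deriv_itvN Hh)).
  exact: within_itv_continuousN.
by move=> x xab /=; rewrite lerN2 hf.
Qed.

Lemma Rintegral_increment_approx a b phi (k : R) e y z :
  mu.-integrable `[a, b] (EFin \o phi) ->
  y \in `[a, b] -> z \in `[a, b] -> y <= z ->
  (forall x, x \in `[y, z] -> `|phi x - k| <= e) ->
  `|Rintegral mu `[a, z] phi - Rintegral mu `[a, y] phi - k * (z - y)| <= e * (z - y).
Proof.
move=> iphi yab zab yz phik.
have aab : a \in `[a, b].
  by move: yab; rewrite !in_itv/= lexx => /andP[]; exact: le_trans.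
have ik : mu.-integrable `[a, b] (EFin \o cst k).
  by apply: within_itv_integrable; exact: within_itv_continuous_cst.
have ipk : mu.-integrable `[a, b] (EFin \o (phi \- cst k)).
  by have /= := integrableB _ iphi ik; exact.
have E x : x \in `[a, b] -> Rintegral mu `[a, x] (phi \- cst k) =
    Rintegral mu `[a, x] phi - k * (x - a).
  move=> xab; rewrite RintegralB//=; [|exact: integrable_itvS aab xab..].
  congr (_ - _); rewrite Rintegral_cst//= lebesgue_measure_itv/= lte_fin.
  move: xab; rewrite in_itv/= => /andP[+ _].
  by rewrite le_eqVlt => /predU1P[->|->//]; rewrite ltxx subrr.
have := Rintegral_increment_norm_le ipk yab zab yz phik.
by rewrite !E//; congr (`|_| <= _); ring.
Qed.

Lemma has_deriv_itv_int a b h : {within `[a, b], continuous h} ->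
  has_deriv_itv a b (fun x => Rintegral mu `[a, x] h) h.
Proof.
move=> ch x xab e e0; have ih := within_itv_integrable ch.
have [d d0 Hd] := (within_itv_continuousP _ _ _).1 ch x xab e e0.
exists d => // y yab yd.
have /andP[ax xb] : a <= x <= b by rewrite in_itv in xab.
have /andP[ay yb] : a <= y <= b by rewrite in_itv in yab.
have near_x t : t \in `[a, b] -> `|t - x| <= `|y - x| -> `|h t - h x| <= e.
  by move=> tab tx; rewrite ltW// Hd// (le_lt_trans tx).
have [xy|yx] := leP x y.
  rewrite [`|y - x|]ger0_norm ?subr_ge0//.
  apply: (Rintegral_increment_approx ih xab yab xy) => t.
  rewrite in_itv/= => /andP[xt ty]; apply: near_x.
    by rewrite in_itv/=; apply/andP; split; lra.
  by rewrite !ger0_norm ?subr_ge0//; lra.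
rewrite -normrN [`|y - x|]distrC [`|x - y|]ger0_norm ?subr_ge0 ?(ltW yx)//.
have -> : - (Rintegral mu `[a, y] h - Rintegral mu `[a, x] h - h x * (y - x)) =
  Rintegral mu `[a, x] h - Rintegral mu `[a, y] h - h x * (x - y) by ring.
apply: (Rintegral_increment_approx ih yab xab (ltW yx)) => t.
rewrite in_itv/= => /andP[yt tx]; apply: near_x.
  by rewrite in_itv/=; apply/andP; split; lra.
by rewrite !ler0_norm ?subr_le0 ?(ltW yx)//; lra.
Qed.

(* Riemann integrability of [phi], with continuous bounds in place of step
   functions. *)
Definition continuous_sandwich a b phi := forall e, 0 < e ->
  exists h1 h2 : R -> R, [/\ {within `[a, b], continuous h1},
    {within `[a, b], continuous h2},
    forall x, x \in `[a, b] -> h1 x <= phi x <= h2 x &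
    Rintegral mu `[a, b] h2 - Rintegral mu `[a, b] h1 <= e].

(** One pair of primitives serves both integrals, since a derivative relative to the segment bounds
    Perron and Laplace derivates alike. *)
Lemma continuous_sandwich_integral a b phi : a < b ->
  mu.-integrable `[a, b] (EFin \o phi) -> continuous_sandwich a b phi ->
  perron_integral a b phi (Rintegral mu `[a, b] phi) /\
  laplace_integral a b phi (Rintegral mu `[a, b] phi).
Proof.
move=> ab iphi sphi.
have Ia0 (h : R -> R) : Rintegral mu `[a, a] h = 0 by rewrite set_itv1 Rintegral_set1.
have approx e : 0 < e -> exists H1 H2 h1 h2,
    [/\ has_deriv_itv a b H1 h1 /\ {within `[a, b], continuous H1},
      has_deriv_itv a b H2 h2 /\ {within `[a, b], continuous H2},
      forall x, x \in `[a, b] -> h1 x <= phi x <= h2 x,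
      Rintegral mu `[a, b] phi - e < H1 b - H1 a &
      H2 b - H2 a < Rintegral mu `[a, b] phi + e].
  move=> e0; have e20 : 0 < e / 2 by rewrite divr_gt0.
  have [h1 [h2 [ch1 ch2 h12 I12]]] := sphi _ e20.
  have [ih1 ih2] := (within_itv_integrable ch1, within_itv_integrable ch2).
  exists (fun x => Rintegral mu `[a, x] h1), (fun x => Rintegral mu `[a, x] h2), h1, h2.
  have I1 : Rintegral mu `[a, b] h1 <= Rintegral mu `[a, b] phi.
    by apply: le_Rintegral => // x /h12/andP[].
  have I2 : Rintegral mu `[a, b] phi <= Rintegral mu `[a, b] h2.
    by apply: le_Rintegral => // x /h12/andP[].
  have [J1 J2] : Rintegral mu `[a, b] phi - e < Rintegral mu `[a, b] h1 /\
      Rintegral mu `[a, b] h2 < Rintegral mu `[a, b] phi + e.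
    move: I1 I2 I12; move: (Rintegral mu _ phi) (Rintegral mu _ h1) (Rintegral mu _ h2).
    by move=> A B C ? ? ?; split; lra.
  rewrite !Ia0 !subr0; split=> //.
    by split; [exact: has_deriv_itv_int|exact: within_itv_continuous_int (ltW ab) ih1].
  by split; [exact: has_deriv_itv_int|exact: within_itv_continuous_int (ltW ab) ih2].
split.
  apply: perron_integral_intro => // e /approx[H1 [H2 [h1 [h2 [[D1 _] [D2 _] h12 I1 I2]]]]].
  exists H2, H1; split=> //.
    by apply: has_deriv_itv_perron_major D2 _ => x /h12/andP[].
  by apply: has_deriv_itv_perron_minor D1 _ => x /h12/andP[].
apply: laplace_integral_intro => // e /approx[H1 [H2 [h1 [h2 [[D1 c1] [D2 c2] h12 I1 I2]]]]].
exists H2, H1; split=> //.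
  by apply: has_deriv_itv_laplace_major D2 _ => // x /h12/andP[].
by apply: has_deriv_itv_laplace_minor D1 _ => // x /h12/andP[].
Qed.

End Perron.

(** * Functions of bounded variation *)
Section ContinuousSandwich.
Context {R : realType}.
Notation mu := (@lebesgue_measure R).
Implicit Types (a b c d r s x y z t C e : R) (f g h k p n phi psi F H K : R -> R).

Lemma eq_continuous_sandwich a b phi psi : {in `[a, b], phi =1 psi} ->
  continuous_sandwich a b phi -> continuous_sandwich a b psi.
Proof.
move=> E sphi e /sphi[h1 [h2 [ch1 ch2 h12 I12]]]; exists h1, h2; split=> // x xab.
by rewrite -E//; exact: h12.
Qed.

Lemma continuous_sandwichB a b phi psi : continuous_sandwich a b phi ->
  continuous_sandwich a b psi -> continuous_sandwich a b (phi \- psi).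
Proof.
move=> sphi spsi e e0; have e20 : 0 < e / 2 by rewrite divr_gt0.
have [h1 [h2 [ch1 ch2 h12 I12]]] := sphi _ e20.
have [k1 [k2 [ck1 ck2 k12 J12]]] := spsi _ e20.
exists (h1 \- k2), (h2 \- k1); split.
- exact: within_itv_continuousB.
- exact: within_itv_continuousB.
- move=> x xab; have := h12 x xab; have := k12 x xab => /=.
  by move=> /andP[? ?] /andP[? ?]; rewrite !lerB.
- rewrite !RintegralB//; try exact: within_itv_integrable.
  move: I12 J12; move: (Rintegral mu _ h1) (Rintegral mu _ h2).
  by move: (Rintegral mu _ k1) (Rintegral mu _ k2) => A B A' B' ? ?; lra.
Qed.

Lemma continuous_sandwich_mulr_ge0 a b F C phi : {within `[a, b], continuous F} ->
  0 <= C -> (forall x, x \in `[a, b] -> 0 <= F x <= C) ->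
  continuous_sandwich a b phi -> continuous_sandwich a b (F \* phi).
Proof.
move=> cF C0 F0C sphi e e0.
have C10 : 0 < C + 1 by rewrite ltr_wpDl.
have [h1 [h2 [ch1 ch2 h12 I12]]] := sphi _ (divr_gt0 e0 C10).
have cF1 := within_itv_continuousM cF ch1; have cF2 := within_itv_continuousM cF ch2.
exists (F \* h1), (F \* h2); split=> //.
  move=> x xab /=; have /andP[F0 _] := F0C x xab; have /andP[? ?] := h12 x xab.
  by rewrite !ler_wpM2l.
rewrite -RintegralB//; try exact: within_itv_integrable.
apply: (@le_trans _ _ (Rintegral mu `[a, b] (fun x => C * (h2 x - h1 x)))).
  apply: le_Rintegral => //=.
  - by apply: within_itv_integrable; exact: within_itv_continuousB.
  - apply: within_itv_integrable; apply: within_itv_continuousM.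
      exact: within_itv_continuous_cst.
    exact: within_itv_continuousB.
  - move=> x xab; have /andP[_ FC] := F0C x xab; have /andP[? ?] := h12 x xab.
    by rewrite -mulrBr ler_wpM2r//; lra.
rewrite RintegralZl//; last by apply: within_itv_integrable; exact: within_itv_continuousB.
rewrite RintegralB//; try exact: within_itv_integrable.
apply: le_trans (ler_wpM2l C0 I12) _.
rewrite mulrCA ler_piMr ?(ltW e0)// ler_pdivrMr// mul1r lerDl//.
Qed.

Lemma continuous_sandwichM a b F phi : {within `[a, b], continuous F} ->
  continuous_sandwich a b phi -> continuous_sandwich a b (F \* phi).
Proof.
move=> cF sphi; have [M M0 FM] := within_itv_bounded cF.
have cM := @within_itv_continuous_cst _ a b M.
(* Multiplication preserves the order of a sandwich only for nonnegative factors; [F + M] and [M]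
   are such. *)
have -> : F \* phi = ((F \+ cst M) \* phi) \- (cst M \* phi).
  by apply/funext => x /=; ring.
apply: continuous_sandwichB.
  apply: (@continuous_sandwich_mulr_ge0 _ _ _ (2 * M)) => //.
  - exact: within_itv_continuousD.
  - by rewrite mulr_ge0.
  - move=> x /FM; rewrite ler_norml /= => /andP[? ?]; apply/andP; split; lra.
apply: (@continuous_sandwich_mulr_ge0 _ _ _ M) => //.
by move=> x _ /=; rewrite M0 lexx.
Qed.

(* The difference quotients of [Gam], the primitive of [g], bound [g] since
   [g] is nondecreasing; they are continuous, and their integrals over [a, b]
   are increments of difference quotients of the primitive of [Gam]. *)
Lemma nondecreasing_continuous_sandwich a b g C : a < b -> nondecreasing_fun g ->
  (forall x, `|g x| <= C) -> continuous_sandwich a b g.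
Proof.
move=> ab ndg gC e e0.
have C0 : 0 <= C by exact: le_trans (gC a).
have C10 : 0 < C + 1 by rewrite ltr_wpDl.
(* Four values, each off by at most [C r], make up the final error; [r <= 1] keeps the shifted
   points inside [[a - 1, b + 1]]. *)
pose r := Num.min 1 (e / (4 * (C + 1))).
have r0 : 0 < r by rewrite lt_min ltr01 divr_gt0// mulr_gt0.
have r1 : r <= 1 by rewrite ge_min lexx.
have rC : 4 * (C * r) <= e.
  have : r <= e / (4 * (C + 1)) by rewrite ge_min lexx orbT.
  rewrite ler_pdivlMr ?mulr_gt0//; nra.
pose c := a - 1; pose d := b + 1.
have cd : c < d by rewrite /c /d; lra.
have shift x s : x \in `[a, b] -> -1 <= s <= 1 -> x + s \in `[c, d].
  rewrite !in_itv/= /c /d => /andP[? ?] /andP[? ?]; apply/andP; split; lra.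
have shift_bounds s : - r <= s <= 0 -> -1 <= s <= 1 /\ -1 <= s + r <= 1.
  by move=> /andP[? ?]; split; apply/andP; split; lra.
have dist_le s x t : - r <= s <= 0 -> x + s <= t -> t <= x + (s + r) -> `|t - x| <= r.
  by move=> /andP[? ?] ? ?; rewrite ler_norml; apply/andP; split; lra.
have close (p q p' q' u v : R) : `|p - u| <= C * r -> `|q - v| <= C * r ->
    `|p' - u| <= C * r -> `|q' - v| <= C * r -> p - q - (p' - q') <= e.
  by rewrite !ler_norml => /andP[? ?] /andP[? ?] /andP[? ?] /andP[? ?]; lra.
have u1 : (- r <= 0) && ((0 : R) <= 0) by rewrite oppr_le0 (ltW r0) lexx.
have u2 : (- r <= - r) && (- r <= 0) by rewrite oppr_le0 (ltW r0) lexx.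
have xltr x : x < x + r by rewrite ltrDl.
have xrlt x : x - r < x by rewrite gtrBl.
have sltr s x : x + s < x + (s + r) by rewrite ltrD2l ltrDl.
have mg : measurable_fun `[c, d] g by exact: nondecreasing_measurable.
have ig : mu.-integrable `[c, d] (EFin \o g).
  by apply: (bounded_integrable (D := C)).
pose Gam x := Rintegral mu `[c, x] g.
have cGam : {within `[c, d], continuous Gam} by exact: within_itv_continuous_int (ltW cd) ig.
have iGam := within_itv_integrable cGam.
have lipGam x y : x \in `[c, d] -> y \in `[c, d] -> `|Gam y - Gam x| <= C * `|y - x|.
  move=> xcd ycd; have [xy|yx] := leP x y.
    by rewrite [`|y - x|]ger0_norm ?subr_ge0//; exact: Rintegral_increment_norm_le ig _ _ _ _.
  rewrite distrC [`|y - x|]distrC [`|x - y|]ger0_norm ?subr_ge0 ?(ltW yx)//.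
  exact: Rintegral_increment_norm_le ig ycd xcd (ltW yx) _.
pose The x := Rintegral mu `[c, x] Gam.
have dThe : has_deriv_itv c d The Gam by exact: has_deriv_itv_int.
(* [s = - r] gives the backward quotient, below [g], and [s = 0] the forward one, above [g]. *)
pose h s x := r^-1 * (Gam (x + (s + r)) - Gam (x + s)).
pose K s x := r^-1 * (The (x + (s + r)) - The (x + s)).
have cshift s : -1 <= s <= 1 -> {within `[a, b], continuous (fun x => Gam (x + s))}.
  move=> s1; apply: (within_itv_continuous_comp (a := c) (b := d) (f := Gam)) => //.
    apply: continuous_subspaceT => t.
    by apply: (@cvgD _ R^o); [exact: cvg_id|exact: cvg_cst].
  by move=> x xab; exact: shift.
have ch s : - r <= s <= 0 -> {within `[a, b], continuous (h s)}.
  move=> /shift_bounds[s1 sr1].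
  apply: within_itv_continuousM; first exact: within_itv_continuous_cst.
  by apply: within_itv_continuousB; exact: cshift.
have dK s : - r <= s <= 0 -> has_deriv_itv a b (K s) (h s).
  by move=> /shift_bounds[s1 sr1]; apply: has_deriv_itvZ; apply: has_deriv_itvB;
    apply: has_deriv_itv_shift dThe _ => x xab; exact: shift.
have Ih s : - r <= s <= 0 -> Rintegral mu `[a, b] (h s) = K s b - K s a.
  move=> sr; have := has_deriv_itv_increment ab (has_deriv_itv_int (ch s sr)) (dK s sr).
  by rewrite set_itv1 Rintegral_set1 subr0.
have xcd x : x \in `[a, b] -> x \in `[c, d].
  by move=> xab; rewrite -[x]addr0 shift// ler01 lerN10.
(* [K s x] is the mean of the [C]-Lipschitz function [Gam] over an interval of length [r] containing
   [x]. *)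
have KGam s x : - r <= s <= 0 -> x \in `[a, b] -> `|K s x - Gam x| <= C * r.
  move=> sr xab; have [s1 sr1] := shift_bounds s sr.
  have ycd := shift x s xab s1; have zcd := shift x (s + r) xab sr1.
  have -> : K s x - Gam x = r^-1 * (The (x + (s + r)) - The (x + s) -
      Gam x * (x + (s + r) - (x + s))) by rewrite /K; field; rewrite gt_eqF.
  rewrite normrM normfV (gtr0_norm r0) ler_pdivrMl//.
  have -> : r * (C * r) = C * r * (x + (s + r) - (x + s)) by ring.
  apply: (Rintegral_increment_approx iGam ycd zcd (ltW (sltr s x))).
  move=> t; rewrite in_itv/= => /andP[yt tz].
  have tcd : t \in `[c, d].
    move: ycd zcd; rewrite !in_itv/= => /andP[cy _] /andP[_ zd].
    by rewrite (le_trans cy yt) (le_trans tz zd).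
  apply: le_trans (lipGam x t (xcd x xab) tcd) _; apply: ler_wpM2l => //.
  exact: dist_le sr yt tz.
exists (h (- r)), (h 0); split; [exact: ch|exact: ch| |].
- move=> x xab.
  have ycd : x - r \in `[c, d] by apply: shift => //; exact: (shift_bounds _ u2).1.
  have zcd : x + r \in `[c, d].
    by apply: shift => //; rewrite -[r]add0r; exact: (shift_bounds _ u1).2.
  rewrite /h addNr addr0 add0r; apply/andP; split.
    rewrite ler_pdivrMl//; have -> : r * g x = g x * (x - (x - r)) by ring.
    apply: (Rintegral_increment_le ig ycd (xcd x xab) (ltW (xrlt x))).
    by move=> t; rewrite in_itv/= => /andP[_ ?]; exact: ndg.
  rewrite ler_pdivlMl//; have -> : r * g x = g x * (x + r - x) by ring.
  apply: (Rintegral_increment_ge ig (xcd x xab) zcd (ltW (xltr x))).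
  by move=> t; rewrite in_itv/= => /andP[? _]; exact: ndg.
- have aab : a \in `[a, b] by rewrite in_itv/= lexx ltW.
  have bab : b \in `[a, b] by rewrite in_itv/= lexx ltW.
  by rewrite !Ih//; apply: (close _ _ _ _ (Gam b) (Gam a)); exact: KGam.
Qed.

(** The difference quotients above look outside [[a, b]], so [g] is extended by its endpoint
    values. *)
Lemma nondecreasing_clamp a b g : a <= b -> {in `[a, b] &, nondecreasing_fun g} ->
  exists g' C, [/\ nondecreasing_fun g', {in `[a, b], g' =1 g} & forall x, `|g' x| <= C].
Proof.
move=> ab ndg; pose cl x := Num.max a (Num.min b x).
have clab x : cl x \in `[a, b] by rewrite in_itv/= le_max lexx ge_max ab ge_min lexx.
exists (g \o cl), (`|g a| + `|g b|); split.
- move=> x y xy /=; apply: ndg => //.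
  by rewrite /cl ge_max !le_max lexx/= le_min !ge_min lexx xy !orbT.
- move=> x; rewrite in_itv/= => /andP[ax xb].
  by rewrite /cl /= (min_r xb) (max_r ax).
- move=> x /=; have aab : a \in `[a, b] by rewrite in_itv/= lexx.
  have bab : b \in `[a, b] by rewrite in_itv/= lexx ab.
  have /andP[acl clb] : a <= cl x <= b by have := clab x; rewrite in_itv.
  have lo := ndg _ _ aab (clab x) acl; have hi := ndg _ _ (clab x) bab clb.
  have := ler_norm (g b); have := ler_norm (- g a); rewrite normrN ler_norml.
  have := normr_ge0 (g a); have := normr_ge0 (g b).
  by move=> ? ? ? ?; apply/andP; split; lra.
Qed.

(** Jordan decomposition. The sandwich is wanted on every [[a, x]], because [G] has to be identified
    at each [x]. *)
Lemma bounded_variation_sandwich a b g : a < b -> bounded_variation a b g ->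
  [/\ measurable_fun `[a, b] g, exists C, forall x, x \in `[a, b] -> `|g x| <= C &
    forall x, a < x -> x <= b -> continuous_sandwich a x g].
Proof.
move=> ab bvg.
(* The positive variation of [g] is the negative variation of [- g]. *)
have ndp : {in `[a, b] &, nondecreasing_fun (fine \o pos_tv a g)}.
  exact: fine_neg_tv_nondecreasing (bounded_variationN bvg).
have ndn := fine_neg_tv_nondecreasing bvg.
have [p [C [ndp' pE pC]]] := nondecreasing_clamp (ltW ab) ndp.
have [n [D [ndn' nE nD]]] := nondecreasing_clamp (ltW ab) ndn.
have gE : {in `[a, b], p \- n =1 g}.
  by move=> x xab; rewrite (bounded_variation_pos_neg_tvE bvg xab) /= pE ?nE.
split.
- apply: (eq_measurable_fun (p \- n)).
    by move=> x; rewrite inE => xab; exact: gE.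
  by apply: measurable_funB; exact: nondecreasing_measurable.
- exists (C + D) => x xab; rewrite -gE//= (le_trans (ler_normB _ _))//.
  by rewrite lerD.
- move=> x ax xb; apply: (@eq_continuous_sandwich _ _ (p \- n)).
    move=> y yax; apply: gE; move: yax; rewrite !in_itv/= => /andP[-> /le_trans].
    exact.
  by apply: continuous_sandwichB; exact: nondecreasing_continuous_sandwich.
Qed.

End ContinuousSandwich.

Theorem theorem6p3 (R : realType) (a b : R) (f g : R -> R) :
  a < b ->
  laplace_integrable a b f ->
  bounded_variation a b g ->
  let F := fun x => lapint a x f in
  let G := fun x => lapint a x g in
  exists P : R,
    perron_integral a b (fun x => F x * g x) P /\
    laplace_integral a b (fun x => f x * G x) (F b * G b - P).
Proof.
move=> ab intf bvg F G.
have [mg [C gC] sg] := bounded_variation_sandwich ab bvg.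
have ig := bounded_integrable mg gC.
have aab : a \in `[a, b] by rewrite in_itv/= lexx ltW.
have bab : b \in `[a, b] by rewrite in_itv/= lexx ltW.
(* [G] is a Laplace integral, whereas the integration by parts is proved for the Lebesgue primitive
   of [g]. *)
have GE x : x \in `[a, b] -> G x = Rintegral (@lebesgue_measure R) `[a, x] g.
  move=> xab; move: (xab); rewrite in_itv/= => /andP[].
  rewrite le_eqVlt => /predU1P[<- _|ax xb].
    by rewrite /G lapint_set1 set_itv1 Rintegral_set1.
  have igx := integrable_itvS ig aab xab.
  exact: lapintE (continuous_sandwich_integral ax igx (sg x ax xb)).2.
have cF : {within `[a, b], continuous F} by exact: lapint_continuous.
exists (Rintegral (@lebesgue_measure R) `[a, b] (F \* g)); split.
  have iFg := continuousM_integrable cF mg gC.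
  exact: (continuous_sandwich_integral ab iFg (continuous_sandwichM cF (sg b ab (lexx b)))).1.
rewrite GE//; apply: eq_laplace_integral (laplace_integral_by_parts ab intf mg gC).
by move=> x xab; rewrite /= GE.
Qed.
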